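(* Let $\Gamma$ be a finite simple graph (a finite simplicial complex of dimension at most $1$) with $|E(\Gamma)|$ edges, and let $\eta(\Gamma)=\left\lceil\sqrt{|E(\Gamma)|}\right\rceil$. Then the Morse complex $\mathcal{M}(\Gamma)$ is $(\eta(\Gamma)-2)$-connected. In particular, $\mathcal{M}(\Gamma)$ is connected once $|E(\Gamma)|>1$, simply connected once $|E(\Gamma)|>4$, and, for every integer $m\ge 1$, $(m-1)$-connected once $|E(\Gamma)|>m^2$.
   Context: For a finite abstract simplicial complex $\Delta$ (simplices are non-empty; $\sigma^{(p)}$ indicates $\dim\sigma=p$), a primitive discrete vector field on $\Delta$ is a pair $(\sigma^{(p)},\tau^{(p+1)})$ of simplices with $\sigma<\tau$. A discrete vector field $V$ on $\Delta$ is a collection of primitive discrete vector fields such that each simplex of $\Delta$ occurs in at most one pair of $V$. A $V$-path is a sequence of simplices $\sigma_0^{(p)},\tau_0^{(p+1)},\sigma_1^{(p)},\dots,\tau_{m-1}^{(p+1)},\sigma_m^{(p)}$ such that for each $0\le i\le m-1$ we have $(\sigma_i,\tau_i)\in V$ and $\tau_i>\sigma_{i+1}\ne\sigma_i$. A $V$-cycle is a $V$-path with $m>0$ and $\sigma_m=\sigma_0$. $V$ is acyclic if there are no $V$-cycles. The Morse complex $\mathcal{M}(\Delta)$ is the simplicial complex whose simplices are the non-empty acyclic discrete vector fields on $\Delta$, with face relation given by inclusion. A space is $n$-connected if it is non-empty and its homotopy groups $\pi_k$ vanish for all $0\le k\le n$; $(-1)$-connected means non-empty, and being $n$-connected for $n\le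 -2$ is a vacuous condition. *)

(* Defs.v *)
From mathcomp Require Import all_boot all_order all_algebra.
From mathcomp Require Import boolp.
Set Implicit Arguments.
Unset Strict Implicit.
Unset Printing Implicit Defensive.
Import Order.TTheory GRing.Theory Num.Theory.

(* A finite abstract simplicial complex with vertices in V. An element of V is
   a vertex of the complex only when its singleton is a simplex. *)
Record scomplex (V : finType) := SComplex {
  simplices :> {set {set V}};
  simplices_neq0 : set0 \notin simplices;
  simplices_face : forall s t : {set V},
    s \in simplices -> t \subset s -> t != set0 -> t \in simplices }.

Definition dim (V : finType) (s : {set V}) : nat := #|s|.-1.

Section MorseComplex.
Context {V : finType} (D : scomplex V).

Definition primitive_dvf (e : {set V} * {set V}) : bool :=
  [&& e.1 \in D, e.2 \in D, dim e.2 == (dim e.1).+1 & e.1 \proper e.2].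

Definition is_dvf (W : {set {set V} * {set V}}) : bool :=
  [forall e in W, primitive_dvf e] &&
  [forall s in D, #|[set e in W | (e.1 == s) || (e.2 == s)]| <= 1].

(* The path is s 0, t 0, s 1, ..., t m.-1, s m; values of s beyond m and of t
   from m on are irrelevant. *)
Definition V_path (W : {set {set V} * {set V}}) (m : nat)
    (s t : nat -> {set V}) : Prop :=
  exists p : nat,
    [/\ forall i, i <= m -> s i \in D /\ dim (s i) = p,
        forall i, i < m -> t i \in D /\ dim (t i) = p.+1
      & forall i, i < m ->
          [/\ (s i, t i) \in W, s i.+1 \proper t i & s i.+1 != s i]].

Definition V_cycle (W : {set {set V} * {set V}}) (m : nat)
    (s t : nat -> {set V}) : Prop :=
  [/\ V_path W m s t, 0 < m & s m = s 0].

Definition acyclic (W : {set {set V} * {set V}}) : Prop :=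
  ~ exists m s t, V_cycle W m s t.

Definition morse_simplices : {set {set {set V} * {set V}}} :=
  [set W | [&& W != set0, is_dvf W & `[< acyclic W >]]].

Fact morse_neq0 : set0 \notin morse_simplices.
Proof. by rewrite inE eqxx. Qed.

Fact morse_face (W U : {set {set V} * {set V}}) :
  W \in morse_simplices -> U \subset W -> U != set0 ->
  U \in morse_simplices.
Proof.
rewrite !inE => /and3P[_ /andP[/forall_inP Wprim /forall_inP Wone] /asboolP aW].
move=> UW -> /=; apply/andP; split.
  apply/andP; split.
    by apply/forall_inP => e eU; apply: Wprim; exact: (subsetP UW).
  apply/forall_inP => s sD; apply: leq_trans (Wone s sD).
  apply/subset_leq_card/subsetP => e; rewrite !inE => /andP[eU ->].
  by rewrite (subsetP UW).
apply/asboolP => -[m [s [t [[p [sp tp st]] m0 sm]]]].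
apply: aW; exists m, s, t; split=> //; exists p; split=> // i im.
by have [sU ? ?] := st i im; split=> //; exact: (subsetP UW).
Qed.

(* A pair (sigma, tau), as a vertex, stands for the field consisting of that
   single pair. *)
Definition morse_complex : scomplex ({set V} * {set V})%type :=
  SComplex morse_neq0 morse_face.

End MorseComplex.

Definition is_graph (V : finType) (G : scomplex V) : Prop :=
  forall s : {set V}, s \in G -> dim s <= 1.

Definition edges (V : finType) (G : scomplex V) : {set {set V}} :=
  [set s in G | dim s == 1].

From mathcomp Require Import all_classical all_reals all_analysis.
Import numFieldTopology.Exports numFieldNormedType.Exports.
Local Open Scope classical_set_scope.
Local Open Scope ring_scope.

Definition eta (R : realType) (V : finType) (G : scomplex V) : int :=
  Num.ceil (Num.sqrt (#|edges G|%:R : R)).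

(* Barycentric coordinates in R^V, with the product topology. *)
Definition realization (R : realType) (V : finType) (K : scomplex V) :
    set {ptws V -> R} :=
  [set x : {ptws V -> R} | [/\ forall v, 0 <= x v, \sum_v x v = 1
                             & [set v | x v != 0]%SET \in simplices K]].

Arguments eta R {V} G.
Arguments realization R {V} K.

(* Homotopy theory of a subset X of a topological space T, with its subspace
   topology. Maps into X are total functions that are only constrained on their
   intended domain. *)
Section Homotopy.
Context {R : realType} {T : topologicalType}.
Implicit Types (X : set T) (x : T) (k : nat).

Definition cube k : set 'rV[R]_k := [set u | forall i, 0 <= u ord0 i <= 1].

Definition cube_boundary k : set 'rV[R]_k :=
  [set u | cube u /\ exists i, u ord0 i = 0 \/ u ord0 i = 1].

Definition sphere_map k X x (f : 'rV[R]_k -> T) : Prop :=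
  [/\ {within @cube k, continuous f},
      forall u, cube u -> X (f u)
    & forall u, cube_boundary u -> f u = x].

Definition homotopic_rel k X x (f g : 'rV[R]_k -> T) : Prop :=
  exists H : 'rV[R]_k * R -> T,
    [/\ {within @cube k `*` (`[0, 1] : set R), continuous H},
        forall u (r : R), cube u -> 0 <= r <= 1 -> X (H (u, r)),
        forall u, cube u -> H (u, 0) = f u,
        forall u, cube u -> H (u, 1) = g u
      & forall u (r : R), cube_boundary u -> 0 <= r <= 1 -> H (u, r) = x].

Definition homotopy_class k X x (f : 'rV[R]_k -> T) : set ('rV[R]_k -> T) :=
  [set g | sphere_map X x g /\ homotopic_rel X x f g].

(* The underlying set of pi_k(X, x), as a set of homotopy classes. For k = 0 the
   cube is a point with empty boundary, and this is the set of path components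
   of X. *)
Definition homotopy_group k X x : set (set ('rV[R]_k -> T)) :=
  [set homotopy_class X x f | f in sphere_map X x].

Definition homotopy_group_trivial k X x : Prop :=
  @homotopy_group k X x = [set homotopy_class X x (cst x)].

Definition n_connected (n : int) X : Prop :=
  (-1 <= n -> X !=set0) /\
  forall k, k%:Z <= n -> forall x, X x -> homotopy_group_trivial k X x.

Definition path_connected X : Prop :=
  X !=set0 /\
  forall x y, X x -> X y -> exists g : R -> T,
    [/\ {within (`[0, 1] : set R), continuous g},
        forall r : R, 0 <= r <= 1 -> X (g r), g 0 = x & g 1 = y].

Definition simply_connected X : Prop :=
  path_connected X /\ forall x, X x -> homotopy_group_trivial 1 X x.

End Homotopy.

(* The real field R is not determined by the space alone. *)
Arguments homotopy_group R {T} k X x.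
Arguments homotopy_group_trivial R {T} k X x.
Arguments n_connected R {T} n X.
Arguments path_connected R {T} X.
Arguments simply_connected R {T} X.

(* Main.v *)
Require Import Defs.
From mathcomp Require Import all_boot all_order all_algebra.
From mathcomp Require Import boolp zify.
Set Implicit Arguments.
Unset Strict Implicit.
Unset Printing Implicit Defensive.

(* Reading a pair ({x}, {x, y}) as the arc x -> y, the Morse complex of a graph
   is the complex of rooted forests: sets of arcs in which every vertex has at
   most one outgoing arc and which contain no directed cycle.  If a set S of s
   arcs forms disjoint stars directed towards their centres, then every rooted
   forest T disjoint from S can be completed by at least s - |T| arcs of S: drop
   the arcs of S leaving a vertex from which T already has an arc, and those
   lying on a cycle.  Hence, deleting the arcs outside S one at a time and
   passing to links, the Morse complex is built from a vertex by elementary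
   expansions and by attaching simplices of dimension at least s - 1 along their
   boundary, so it is (s-2)-connected.  A graph with more than d^2 edges has a
   star with d + 1 edges or more than 2 d non-isolated vertices; in the latter
   case a maximal independent set of non-isolated vertices or its complement
   provides a star forest with d + 1 arcs.

   On the topological side, a map of a k-sphere into a realization is homotopic
   to a Lipschitz one, a Lipschitz map misses an open subset of every simplex of
   dimension greater than k by a counting argument, and it can then be pushed
   radially into the boundary of that simplex. *)

(** * Complexes built by expansions and attachments *)

Section Build.
Context {P : finType}.
Implicit Types (K L : {set {set P}}) (s t F : {set P}) (a v : P) (d : nat).

Definition complex K :=
  set0 \notin K /\
  forall s t, s \in K -> t \subset s -> t != set0 -> t \in K.

(* Elementary expansions preserve the homotopy type, and attaching a simplex of
   dimension at least [d] along its boundary preserves (d-1)-connectedness, so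
   [build d K] is a combinatorial certificate that [K] is (d-1)-connected. *)
Inductive build d : {set {set P}} -> Prop :=
| Build_vertex v : build d [set [set v]]
| Build_expand K s v : build d K -> s != set0 -> s \notin K -> v \notin s ->
    (forall t, t \subset v |: s -> t != set0 -> t != s -> t != v |: s ->
      t \in K) ->
    build d ([set s; v |: s] :|: K)
| Build_attach K s : build d K -> d < #|s| -> s \notin K ->
    (forall t, t \proper s -> t != set0 -> t \in K) ->
    build d (s |: K).

Lemma build_complex d K : build d K -> complex K.
Proof.
elim=> {K} [v|K s v _ [K0 Kf] s0 sK vs fs|K s _ [K0 Kf] ds sK fs].
- split=> [|s t]; rewrite !inE; first by rewrite eq_sym -card_gt0 cards1.
  by move=> /eqP->; rewrite subset1 => /orP[//|->].
- split=> [|s1 t]; rewrite !inE.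
    rewrite ![set0 == _]eq_sym (negPf s0) (negPf K0) orbF /=.
    by apply/set0Pn; exists v; rewrite !inE eqxx.
  case/orP=> [sE ts1 t0|s1K ts1 t0]; last by rewrite (Kf s1) ?orbT.
  case: eqVneq => //= ts; case: eqVneq => //= tvs; apply: fs => //.
  by case/orP: sE ts1 => /eqP-> // /subset_trans; apply; exact: subsetUr.
- have s0 : s != set0 by rewrite -card_gt0; apply: leq_trans ds.
  split=> [|s1 t]; rewrite !inE; first by rewrite eq_sym negb_or s0 K0.
  case/orP=> [/eqP-> ts t0|s1K ts1 t0]; last by rewrite (Kf s1) ?orbT.
  by have [//|nts /=] := eqVneq t s; apply: fs; rewrite // properEneq nts.
Qed.

Lemma build_neq0 d K : build d K -> exists s, s \in K.
Proof.
case=> [v|{}K s v _ _ _ _ _|{}K s _ _ _ _]; [exists [set v]|exists s|exists s];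
  by rewrite !inE eqxx.
Qed.

(** For [d = 0] a simplex of any dimension may be attached, so the simplices of [K] outside [L] are
    added one at a time, smallest first. *)
Lemma build_extend0 K L : build 0 L -> complex K -> L \subset K -> build 0 K.
Proof.
move=> bL cK; have [n] := ubnP #|K :\: L|; elim: n => // n IH in L bL *.
rewrite ltnS => KLn LK.
have [KL0|[s0 s0P]] := set_0Vmem (K :\: L).
  suff <- : L = K by [].
  by apply/eqP; rewrite eqEsubset LK -setD_eq0 KL0 eqxx.
case: (arg_minnP (fun s : {set P} => #|s|) s0P) => s /setDP[sK sL] smin.
have s_neq0 : s != set0 by apply: contraTneq sK => ->; case: cK.
apply: (IH (s |: L)); last by rewrite subUset sub1set sK.
  apply: Build_attach; rewrite ?card_gt0 // => t ts t0.
  apply/negPn/negP => tL.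
  have tK : t \in K by apply: cK.2 sK (proper_sub ts) t0.
  have /smin : t \in K :\: L by rewrite inE tL tK.
  by rewrite leqNgt proper_card.
apply: leq_trans KLn; apply: proper_card; apply/properP; split.
  by apply/subsetP => t; rewrite !inE negb_or -andbA => /and3P[_ -> ->].
by exists s; rewrite !inE ?sL ?sK ?eqxx.
Qed.

Lemma build0 K s : complex K -> s \in K -> build 0 K.
Proof.
move=> cK sK; have /set0Pn[v vs] : s != set0.
  by apply: contraTneq sK => ->; case: cK.
apply: (build_extend0 (Build_vertex 0 v)) => //.
rewrite sub1set; apply: cK.2 sK _ _; first by rewrite sub1set.
by rewrite -card_gt0 cards1.
Qed.

(** The empty set contributes the apex [[set a]]. Added to a complex containing [L], these simplices
    glue on the cone over [L]. *)
Definition coneover a L := [set a |: t | t in set0 |: L].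

(** A certificate of [L] is replayed with [a] joined to every simplex: the initial vertex [w]
    becomes the expansion pair [[set a]], [w |: [set a]], expansions stay expansions, and an
    attached simplex gains one dimension, which accounts for [d.+1]. *)
Lemma build_link d K L a : build d.+1 K -> (forall t, t \in K -> a \notin t) ->
  build d L -> L \subset K -> build d.+1 (coneover a L :|: K).
Proof.
move=> bK aK; have cK := build_complex bK; elim=> {L}.
- move=> w; rewrite sub1set => wK.
  have aw : w \notin [set a].
    by have := aK _ wK; rewrite !inE eq_sym.
  have -> : coneover a [set [set w]] :|: K = [set [set a]; w |: [set a]] :|: K.
    by rewrite /coneover imsetU1 imset_set1 setU0 [a |: _]setUC.
  apply: Build_expand => //.
  + by rewrite -card_gt0 cards1.
  + by apply/negP => /aK; rewrite inE eqxx.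
  + move=> t tw t0 ta taw.
    suff -> : t = [set w] by [].
    have wt : w \in t.
      apply: contra_neqT ta => wt; apply/eqP.
      have : t \subset [set a].
        apply/subsetP => x xt; have := subsetP tw x xt; rewrite !inE.
        by case/orP=> // /eqP xw; rewrite -xw xt in wt.
      by rewrite subset1 (negPf t0) orbF.
    have nat : a \notin t.
      apply: contra_neqN taw => at_; apply/eqP; rewrite eqEsubset tw.
      by rewrite subUset !sub1set wt at_.
    apply/eqP; rewrite eqEsubset sub1set wt andbT.
    apply/subsetP => x xt; have := subsetP tw x xt; rewrite !inE.
    by case/orP=> // /eqP xa; rewrite -xa xt in nat.
- move=> L s v bL IH s0 sL vs fs LK.
  have {}LK : {subset [set s; v |: s] :|: L <= K} by apply/subsetP.
  have cL := build_complex bL.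
  have sK : s \in K by apply: LK; rewrite !inE eqxx.
  have vsK : v |: s \in K by apply: LK; rewrite !inE eqxx orbT.
  have {}IH : build d.+1 (coneover a L :|: K).
    by apply: IH; apply/subsetP => t tL; apply: LK; rewrite inE tL orbT.
  have nas := aK _ sK.
  have nav : v != a by have := aK _ vsK; rewrite !inE eq_sym => /norP[].
  have -> : coneover a ([set s; v |: s] :|: L) :|: K =
            [set a |: s; v |: (a |: s)] :|: (coneover a L :|: K).
    rewrite /coneover !imsetU !imset_set1 [v |: (a |: s)]setUCA.
    by rewrite setUCA -!setUA.
  apply: Build_expand => //.
  + by apply/set0Pn; exists a; rewrite !inE eqxx.
  + rewrite inE; apply/norP; split.
      apply/imsetP => -[t]; rewrite !inE => /orP[/eqP->|tL] ast.
        case/set0Pn: s0 => x xs; have : x \in a |: s by rewrite !inE xs orbT.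
        by rewrite ast !inE orbF => /eqP xa; rewrite -xa xs in nas.
      have nat : a \notin t by apply/aK/LK; rewrite inE tL orbT.
      by move: sL; rewrite -(setU1K nas) ast setU1K // tL.
    by apply/negP => /aK; rewrite !inE eqxx.
  + by rewrite !inE (negPf vs) orbF.
  + move=> t tvas t0 tas tvas'; rewrite inE.
    have [at_|nat] := boolP (a \in t); last first.
      have tvs : t \subset v |: s.
        apply/subsetP => x xt; have := subsetP tvas x xt; rewrite !inE.
        case/or3P=> [->//|/eqP xa|->]; last by rewrite orbT.
        by rewrite -xa xt in nat.
      by rewrite (cK.2 _ _ vsK tvs t0) orbT.
    apply/orP; left; apply/imsetP; exists (t :\ a); last by rewrite setD1K.
    rewrite !inE; case: eqVneq => //= ta0; apply: fs => //.
    * apply/subsetP => x; rewrite !inE => /andP[xa xt].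
      by have := subsetP tvas x xt; rewrite !inE (negPf xa).
    * by apply: contra_neq tas => <-; rewrite setD1K.
    * by apply: contra_neq tvas' => tE; rewrite setUCA -tE setD1K.
- move=> L s bL IH ds sL fs LK.
  have {}LK : {subset s |: L <= K} by apply/subsetP.
  have sK : s \in K by apply: LK; rewrite !inE eqxx.
  have nas := aK _ sK.
  have {}IH : build d.+1 (coneover a L :|: K).
    by apply: IH; apply/subsetP => t tL; apply: LK; rewrite inE tL orbT.
  have -> : coneover a (s |: L) :|: K = (a |: s) |: (coneover a L :|: K).
    by rewrite /coneover !imsetU !imset_set1 setUCA -!setUA.
  apply: Build_attach => //.
  + by rewrite cardsU1 nas.
  + rewrite inE; apply/norP; split.
      apply/imsetP => -[t]; rewrite !inE => /orP[/eqP->|tL] ast.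
        have : s = set0 by rewrite -(setU1K nas) ast setU0 setDv.
        by move=> s0; rewrite s0 cards0 in ds.
      have nat : a \notin t by apply/aK/LK; rewrite inE tL orbT.
      by move: sL; rewrite -(setU1K nas) ast setU1K // tL.
    by apply/negP => /aK; rewrite !inE eqxx.
  + move=> t /properP[tas [x xas xt]] t0; rewrite inE.
    have [at_|nat] := boolP (a \in t); last first.
      have ts : t \subset s.
        apply/subsetP => y yt; have := subsetP tas y yt; rewrite !inE.
        by case/orP=> // /eqP ya; rewrite -ya yt in nat.
      by rewrite (cK.2 _ _ sK ts t0) orbT.
    apply/orP; left; apply/imsetP; exists (t :\ a); last by rewrite setD1K.
    rewrite !inE; case: eqVneq => //= ta0; apply: fs => //.
    apply/properP; split.
      apply/subsetP => y; rewrite !inE => /andP[ya yt].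
      by have := subsetP tas y yt; rewrite !inE (negPf ya).
    exists x; last by rewrite !inE (negPf xt) andbF.
    move: xas; rewrite !inE => /orP[/eqP xa|//].
    by rewrite xa at_ in xt.
Qed.

Definition deletion K a := [set s in K | a \notin s].
Definition link K a := [set s | [&& s != set0, a \notin s & a |: s \in K]].

(** [K] is its deletion at [a] with the cone over the link glued on, and [build_link] certifies such
    a gluing. *)
Lemma build_del_link d K a : complex K ->
  build d.+1 (deletion K a) -> build d (link K a) -> build d.+1 K.
Proof.
move=> cK bD bL.
have aK : [set a] \in K.
  have [s] := build_neq0 bL; rewrite inE => /and3P[_ _ asK].
  apply: cK.2 asK _ _; first exact: subsetUl.
  by rewrite -card_gt0 cards1.
have -> : K = coneover a (link K a) :|: deletion K a.
  apply/setP => s; rewrite !inE; apply/idP/orP.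
    move=> sK; have [as_|nas] := boolP (a \in s); last by right; rewrite sK.
    left; apply/imsetP; exists (s :\ a); last by rewrite setD1K.
    by rewrite !inE eqxx setD1K // sK /= andbT orbN.
  case=> [/imsetP[t]|/andP[]//]; rewrite !inE.
  by case/orP=> [/eqP->|/and3P[_ _ asK]] ->; rewrite ?setU0.
apply: build_link => //; first by move=> t; rewrite inE => /andP[].
apply/subsetP => s; rewrite !inE => /and3P[s0 nas asK]; rewrite nas andbT.
by apply: cK.2 asK (subsetUr _ _) s0.
Qed.

Lemma complexS F : complex [set t : {set P} | (t \subset F) && (t != set0)].
Proof.
split=> [|s t]; rewrite !inE ?eqxx ?andbF // => /andP[sF _] ts ->.
by rewrite (subset_trans ts).
Qed.

(** Simplices are contractible, hence any [d]: for a vertex [a] of [F], both the deletion and the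
    link are the full simplex on [F :\ a], unless [F] is that vertex alone. *)
Lemma build_simplex d F : F != set0 ->
  build d [set t : {set P} | (t \subset F) && (t != set0)].
Proof.
have [n] := ubnP #|F|; elim: n => // n IH in d F *; rewrite ltnS => Fn F0.
case: d => [|d].
  by apply: (@build0 _ F (complexS F)); rewrite inE subxx.
case/set0Pn: F0 => a aF.
have [Fa0|Fa] := eqVneq (F :\ a) set0.
  suff -> : [set t : {set P} | (t \subset F) && (t != set0)] = [set [set a]].
    exact: Build_vertex.
  rewrite -(setD1K aF) Fa0 setU0; apply/setP => t; rewrite !inE subset1.
  have [->|] := eqVneq t set0; rewrite ?andbT ?orbF // andbF.
  by apply/esym/negbTE; rewrite eq_sym -card_gt0 cards1.
have Fan : #|F :\ a| < n.
  by apply: leq_trans Fn; apply: proper_card; exact: properD1.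
apply: (@build_del_link _ _ a (complexS F)).
  suff -> : deletion [set t : {set P} | (t \subset F) && (t != set0)] a =
    [set t : {set P} | (t \subset F :\ a) && (t != set0)] by exact: IH.
  by apply/setP => t; rewrite !inE subsetD1 andbAC.
suff -> : link [set t : {set P} | (t \subset F) && (t != set0)] a =
  [set t : {set P} | (t \subset F :\ a) && (t != set0)] by exact: IH.
apply/setP => t; rewrite !inE subsetD1 subUset sub1set aF /=.
have -> : a |: t != set0 by apply/set0Pn; exists a; rewrite !inE eqxx.
by rewrite andbT andbC andbAC andbC; case: (_ != _); rewrite ?andbF ?andbT.
Qed.

End Build.

(** * Certificates from an exchange property *)

Section Criterion.
Context {P : finType} (M : {set {set P}}) (cM : complex M).
Implicit Types (B T F G S : {set P}) (b : P) (d : nat).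

Lemma disjointD1U1 B T b : [disjoint B & T] -> [disjoint B :\ b & b |: T].
Proof.
move=> BT; rewrite disjoints_subset; apply/subsetP => x.
by rewrite !inE negb_or => /andP[-> /(disjointFr BT)->].
Qed.

(** For [B] disjoint from [T], the part of the link of [T] in [M] supported on [B]; for [T = set0]
    it is the induced subcomplex on [B]. *)
Definition rlink T B :=
  [set r : {set P} | [&& r != set0, r \subset B & r :|: T \in M]].

Lemma rlink_complex T B : complex (rlink T B).
Proof.
split=> [|s t]; rewrite !inE ?eqxx // => /and3P[s0 sB sM] ts t0.
rewrite t0 (subset_trans ts sB) /=; apply: cM.2 sM _ _; first exact: setSU.
by case/set0Pn: t0 => x xt; apply/set0Pn; exists x; rewrite !inE xt.
Qed.

Lemma deletion_rlink T B b : deletion (rlink T B) b = rlink T (B :\ b).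
Proof.
apply/setP => r; rewrite !inE subsetD1.
by case: (_ != _); case: (_ \subset _); case: (_ \in M); case: (_ \notin _).
Qed.

Lemma link_rlink T B b : b \in B ->
  link (rlink T B) b = rlink (b |: T) (B :\ b).
Proof.
move=> bB; apply/setP => r; rewrite !inE subsetD1 subUset sub1set bB /=.
have -> : b |: r != set0 by apply/set0Pn; exists b; rewrite !inE eqxx.
rewrite /= [b |: r]setUC setUA.
by case: (_ != _); case: (_ \subset _); case: (_ \in M); case: (_ \notin _).
Qed.

Lemma rlink_notin T B b : b |: T \notin M -> rlink T B = rlink T (B :\ b).
Proof.
move=> bTM; apply/setP => r; rewrite !inE subsetD1.
have [br|] := boolP (b \in r); last by rewrite andbT.
rewrite !andbF; apply/negbTE/negP => /and3P[r0 _ rM].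
case/negP: bTM; apply: cM.2 rM _ _.
  by apply: setSU; rewrite sub1set.
by apply/set0Pn; exists b; rewrite !inE eqxx.
Qed.

Lemma build_exchange S :
  (forall T F b, F \subset S -> b \in S -> b \notin F -> [disjoint F & T] ->
     F :|: T \in M -> b |: T \in M ->
     exists G, [/\ G \subset F, #|F| <= #|G|.+1 & G :|: (b |: T) \in M]) ->
  forall B T F d, B \subset S -> F \subset B -> [disjoint B & T] ->
  F :|: T \in M -> d < #|F| -> build d (rlink T B).
Proof.
move=> exch B; have [n] := ubnP #|B|; elim: n => // n IH in B *.
rewrite ltnS => Bn T F d BS FB BT FTM dF.
have F0 : F != set0 by rewrite -card_gt0; apply: leq_ltn_trans dF.
case: d => [|d] in dF *.
  by apply: (@build0 _ _ F (rlink_complex T B)); rewrite inE F0 FB.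
have [BF|[b /setDP[bB bF]]] := set_0Vmem (B :\: F).
  suff -> : rlink T B = [set t : {set P} | (t \subset F) && (t != set0)].
    exact: build_simplex.
  have -> : B = F by apply/eqP; rewrite eqEsubset FB -setD_eq0 BF eqxx.
  apply/setP => r; rewrite !inE andbA [in RHS]andbC.
  apply: andb_idr => /andP[r0 rF]; apply: cM.2 FTM _ _; first exact: setSU.
  by case/set0Pn: r0 => x xr; apply/set0Pn; exists x; rewrite !inE xr.
have Bbn : #|B :\ b| < n.
  by apply: leq_trans Bn; apply: proper_card; exact: properD1.
have BbS : B :\ b \subset S by apply: subset_trans BS; exact: subD1set.
have FBb : F \subset B :\ b by rewrite subsetD1 FB.
have BbT : [disjoint B :\ b & T] by apply: disjointWl BT; exact: subD1set.
have del : build d.+1 (rlink T (B :\ b)) by apply: (IH _ _ T F).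
have [bTM|/rlink_notin->//] := boolP (b |: T \in M).
apply: (@build_del_link _ _ _ b (rlink_complex T B)).
  by rewrite deletion_rlink.
rewrite link_rlink //.
have [|||G [GF FG GM]] := exch T F b _ _ bF _ FTM bTM.
- exact: subset_trans BS.
- exact: subsetP bB.
- exact: disjointWl BT.
apply: (IH _ _ _ G) => //; first exact: subset_trans FBb.
  exact: disjointD1U1.
by rewrite -ltnS; apply: leq_trans FG.
Qed.

(** First the vertices outside [S] are removed, each link moving one of them into [T]. When only [S]
    is left, the second hypothesis supplies a large simplex [F] inside [S] compatible with [T], and
    [build_exchange] takes over. *)
Lemma build_criterion S :
  (forall T F b, F \subset S -> b \in S -> b \notin F -> [disjoint F & T] ->
     F :|: T \in M -> b |: T \in M ->
     exists G, [/\ G \subset F, #|F| <= #|G|.+1 & G :|: (b |: T) \in M]) ->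
  (forall T, T = set0 \/ T \in M -> [disjoint S & T] -> #|T| < #|S| ->
     exists F, [/\ F \subset S, #|S| <= #|F| + #|T| & F :|: T \in M]) ->
  forall d, d < #|S| -> build d M.
Proof.
move=> exch large.
(* The bound on [#|T| + d] survives passing to a link: [T] grows by one element while [d] drops by
   one. *)
suff claim B T d : S \subset B -> [disjoint B & T] -> T = set0 \/ T \in M ->
    #|T| + d < #|S| -> build d (rlink T B).
  move=> d dS; have -> : M = rlink set0 setT.
    apply/setP => r; rewrite !inE setU0 subsetT /=.
    by case: eqVneq => // ->; apply/negbTE; case: cM.
  apply: claim; rewrite ?subsetT ?cards0 //; last by left.
  by rewrite disjoints_subset setC0 subsetT.
have [n] := ubnP #|B|; elim: n => // n IH in B T d *; rewrite ltnS => Bn.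
move=> SB BT TM TdS.
have [|||F [FS SFT FM]] // := large T.
- exact: disjointWl BT.
- by apply: leq_ltn_trans TdS; exact: leq_addr.
have dF : d < #|F| by rewrite -(ltn_add2l #|T|) [_ + #|F|]addnC (leq_trans TdS).
case: d => [|d] in TdS dF *.
  apply: (@build0 _ _ F (rlink_complex T B)).
  rewrite inE FM (subset_trans FS) //.
  by rewrite -card_gt0 dF.
have [BS|[b /setDP[bB bS]]] := set_0Vmem (B :\: S).
  have BE : B = S by apply/eqP; rewrite eqEsubset SB -setD_eq0 BS eqxx.
  by apply: (build_exchange exch _ _ BT FM) => //; rewrite BE.
have Bbn : #|B :\ b| < n.
  by apply: leq_trans Bn; apply: proper_card; exact: properD1.
have SBb : S \subset B :\ b by rewrite subsetD1 SB.
have BbT : [disjoint B :\ b & T] by apply: disjointWl BT; exact: subD1set.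
have del : build d.+1 (rlink T (B :\ b)) by apply: IH.
have [bTM|/rlink_notin->//] := boolP (b |: T \in M).
apply: (@build_del_link _ _ _ b (rlink_complex T B)).
  by rewrite deletion_rlink.
rewrite link_rlink //; apply: IH => //; last 2 first.
- by right.
- rewrite cardsU1; have -> : b \notin T by rewrite (disjointFr BT).
  by rewrite add1n addSn -addnS.
exact: disjointD1U1.
Qed.

End Criterion.

(** * The Morse complex of a graph *)

Section FunctionalGraph.
Context {V : finType}.
Implicit Types (W U : {set {set V} * {set V}}) (e : {set V} * {set V}).
Implicit Types (s t : {set V}) (i m : nat).

Definition sources W : {set {set V}} := [set e.1 | e in W].

(* In a graph, [succ W] sends [{x}] to [{y}] when [({x}, {x, y})] is in [W], and
   fixes the other simplices. *)
Definition succ W s : {set V} :=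
  if [pick e in W | e.1 == s] is Some e then e.2 :\: e.1 else s.

(** Being a source rules out the simplices that [succ W] fixes by convention, so for rooted forests
    of arcs this detects the vertices on directed cycles. *)
Definition periodic W s :=
  s \in sources W /\ exists m, iter m.+1 (succ W) s = s.

Lemma sourcesS U W : U \subset W -> sources U \subset sources W.
Proof. exact: imsetS. Qed.

Lemma succE W e : {in W &, injective fst} -> e \in W ->
  succ W e.1 = e.2 :\: e.1.
Proof.
move=> injW eW; rewrite /succ; case: pickP => [e'|/(_ e)].
  by move=> /andP[e'W /eqP ee']; rewrite (injW _ _ e'W eW ee').
by rewrite eW eqxx.
Qed.

Lemma succ_notin W s : s \notin sources W -> succ W s = s.
Proof.
move=> sW; rewrite /succ; case: pickP => // e /andP[eW /eqP es].
by move: sW; rewrite -es imset_f.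
Qed.

Lemma succ_sub U W s : U \subset W -> {in W &, injective fst} ->
  s \in sources U -> succ U s = succ W s.
Proof.
move=> /subsetP UW injW /imsetP[e eU ->].
rewrite (succE injW (UW _ eU)) succE // => x y xU yU.
by apply: injW; apply: UW.
Qed.

Lemma periodic_large W s k : periodic W s ->
  exists2 m, k <= m & iter m.+1 (succ W) s = s.
Proof.
move=> [_ [m sm]]; exists (k * m.+1 + m).
  by apply: leq_trans (leq_addr _ _); rewrite leq_pmulr.
by rewrite -addnS -mulSnr iterM; apply: iter_fix.
Qed.

Lemma periodic_source W s i : periodic W s -> iter i (succ W) s \in sources W.
Proof.
move=> ps; have [m im sm] := periodic_large i ps.
apply/negPn/negP => siW; case: ps => + _; apply/negP; rewrite -sm.
rewrite -(subnK (leqW im)) iterD iter_fix //; exact: succ_notin.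
Qed.

Lemma periodic_iter W s i : periodic W s -> periodic W (iter i (succ W) s).
Proof.
move=> ps; split; first exact: periodic_source.
by case: ps => _ [m sm]; exists m; rewrite -iterD addnC iterD sm.
Qed.

Lemma periodicS U W s : U \subset W -> {in W &, injective fst} ->
  periodic U s -> periodic W s /\ forall i, iter i (succ W) s \in sources U.
Proof.
move=> UW injW pU.
have E i : iter i (succ W) s = iter i (succ U) s.
  elim: i => //= i ->; apply/esym/succ_sub => //; exact: periodic_source.
split=> [|i]; last by rewrite E; exact: periodic_source.
case: pU => sU [m sm]; split; first exact: subsetP (sourcesS UW) _ sU.
by exists m; rewrite E.
Qed.

Lemma periodic_sub U W s : U \subset W -> {in W &, injective fst} ->
  periodic W s -> (forall i, iter i (succ W) s \in sources U) -> periodic U s.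
Proof.
move=> UW injW [_ [m sm]] sU; split; first exact: (sU 0).
exists m; rewrite -[RHS]sm; elim: m.+1 => //= i ->; exact: succ_sub.
Qed.

Lemma succ_periodic_inj W s t : periodic W s -> periodic W t ->
  succ W s = succ W t -> s = t.
Proof.
move=> [_ [m sm]] [_ [n tn]] st.
(* Both [s] and [t] are fixed by the iterate of order [m.+1 * n.+1], a common multiple of their
   periods, and this iterate factors through one application of [succ W]. *)
have := iter_fix n.+1 sm; have := iter_fix m.+1 tn; rewrite -!iterM.
by rewrite mulnC mulnS addSn !iterSr st => -> ->.
Qed.

End FunctionalGraph.

(** * Discrete vector fields as rooted forests *)

Section MorseGraph.
Context {V : finType} (G : scomplex V) (hG : is_graph G).
Implicit Types (W U T F S : {set {set V} * {set V}}).
Implicit Types (e b : {set V} * {set V}) (s t : {set V}) (x y : V).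

Lemma primitiveP e : primitive_dvf G e ->
  exists x y, x != y /\ e = ([set x], [set x; y]).
Proof.
case: e => s t /and4P[/= sG tG /eqP dts /properP[st [y yt ys]]].
have s0 : s != set0 by apply: contraTneq sG => ->; exact: simplices_neq0.
have t0 : t != set0 by apply: contraTneq tG => ->; exact: simplices_neq0.
have := hG tG; rewrite dts ltnS leqn0 => /eqP ds.
have /cards1P[x sE] : #|s| == 1.
  by move: ds s0; rewrite /Defs.dim -card_gt0; case: #|s| => [|[]].
have ct : #|t| <= 2 by move: dts; rewrite ds /Defs.dim; case: #|t| => [|[|[]]].
exists x, y; have xy : x != y by move: ys; rewrite sE inE eq_sym.
split=> //; rewrite sE; congr pair; apply/eqP; rewrite eq_sym eqEcard.
by rewrite subUset !sub1set yt (subsetP st) ?sE ?set11 //= cards2 xy.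
Qed.

Lemma pair_setD x y : x != y -> [set x; y] :\: [set x] = [set y].
Proof. by move=> xy; rewrite setU1K // inE. Qed.

(** Injectivity of [fst] gives each vertex at most one outgoing arc. That no edge lies in two pairs
    is covered by the absence of periodic simplices, as the arcs [({x}, {x, y})] and [({y}, {x, y})]
    form a cycle of length two. *)
Definition morse_ok W :=
  [/\ {in W, forall e, primitive_dvf G e}, {in W &, injective fst}
    & forall s, ~ periodic W s].

(** In a graph every pair goes from a vertex to an edge, so a V-path is an orbit segment of [succ W]
    and a V-cycle a periodic orbit. *)
Lemma morse_okP W : W != set0 -> W \in morse_simplices G <-> morse_ok W.
Proof.
move=> W0; rewrite inE W0 /=; split.
  case/andP=> /andP[/forall_inP prW /forall_inP cW] /asboolP aW.
  have injW : {in W &, injective fst}.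
    move=> e e' eW e'W ee'; have /and4P[e1G _ _ _] := prW _ eW.
    by apply: (card_le1_eqP (cW _ e1G)); rewrite !inE ?eW ?e'W ?ee' eqxx.
  split=> // s ps; apply: aW; have [_ [m sm]] := ps.
  (* The V-cycle of a periodic vertex: [f] runs through the orbit and [g] gives the edge of the arc
     leaving [f i]. The default [set0] never occurs, as the whole orbit consists of sources. *)
  pose f i := iter i (succ W) s.
  pose g i := if [pick e in W | e.1 == f i] is Some e then e.2 else set0.
  have fg i : exists x y, [/\ x != y, f i = [set x], g i = [set x; y],
      f i.+1 = [set y] & (f i, g i) \in W].
    have [e eW fi] := imsetP (periodic_source i ps).
    have [x [y [xy eE]]] := primitiveP (prW _ eW); exists x, y.
    have gi : g i = e.2.
      rewrite /g; case: pickP => [e' /andP[e'W /eqP]|/(_ e)].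
        by rewrite /f fi => ee'; rewrite (injW _ _ e'W eW ee').
      by rewrite eW /f fi eqxx.
    have fi1 : f i.+1 = e.2 :\: e.1 by rewrite /f iterS fi succE.
    have {}fi : f i = e.1 by [].
    rewrite fi1 gi fi -surjective_pairing.
    by split=> //; rewrite eE //= pair_setD.
  exists m.+1, f, g; split=> //; exists 0; split=> i _.
  - have [x [y [_ fi _ _ fgW]]] := fg i.
    have /and4P[fG _ _ _] := prW _ fgW.
    by split=> //; rewrite fi /Defs.dim cards1.
  - have [x [y [xy _ gi _ fgW]]] := fg i.
    have /and4P[_ gG _ _] := prW _ fgW.
    by split=> //; rewrite gi /Defs.dim cards2 xy.
  - have [x [y [xy fi gi -> eW]]] := fg i; split=> //.
      rewrite gi properE subsetUr /= subUset sub1set inE.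
      by rewrite (negPf xy).
    by rewrite fi; apply: contra_neq xy => /set1_inj.
case=> prW injW apW; apply/andP; split; [apply/andP; split|].
- exact/forall_inP.
- apply/forall_inP => s sG; apply/card_le1_eqP => e e'.
  rewrite !inE => /andP[eW es] /andP[e'W e's].
  have [x [y [xy eE]]] := primitiveP (prW _ eW).
  have [x' [y' [xy' eE']]] := primitiveP (prW _ e'W).
  move: es e's; rewrite [in e.1]eE [in e.2]eE [in e'.1]eE' [in e'.2]eE' /=.
  case/orP=> /eqP<- /orP[]/eqP.
  + by move/set1_inj => x'x; apply: injW; rewrite // eE eE' x'x.
  + by move/(congr1 (fun s : {set V} => #|s|)); rewrite cards1 cards2 xy'.
  + by move/(congr1 (fun s : {set V} => #|s|)); rewrite cards1 cards2 xy.
  + move=> ss; have [xx'|xx'] := eqVneq x x'.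
      by apply: injW; rewrite // eE eE' xx'.
    have /eqP yx' : y == x'.
      by have := set21 x' y'; rewrite ss !inE eq_sym (negPf xx') eq_sym.
    have /eqP y'x : y' == x.
      have := set21 x y; rewrite -ss !inE (negPf xx') /=.
      by rewrite eq_sym.
    (* Distinct sources on one edge: each arc ends where the other starts, so [e.1] has period
       two. *)
    case: (apW e.1); split; first exact: imset_f.
    exists 1 => /=; rewrite succE // eE pair_setD // yx'.
    by have := succE injW e'W; rewrite eE' pair_setD //= => ->; rewrite y'x.
- apply/asboolP => -[m [s [t [[p [sp tp st]] m0 sm]]]].
  have step i : i < m -> s i.+1 = succ W (s i).
    move=> im; have [iW sti si] := st i im.
    have [x [y [xy [six tixy]]]] := primitiveP (prW _ iW).
    rewrite -[s i]/(s i, t i).1 succE //= six tixy pair_setD //.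
    have [sG ds] := sp i.+1 im; have [_ ds'] := sp i (ltnW im).
    have /eqP/cards1P[z sz] : #|s i.+1| = 1.
      move: ds; rewrite -ds' six /Defs.dim cards1 /=.
      have : s i.+1 != set0.
        by apply: contraTneq sG => ->; exact: simplices_neq0.
      by rewrite -card_gt0; case: #|s i.+1| => [|[]].
    move: sti si; rewrite sz six tixy => /proper_sub; rewrite sub1set !inE.
    by case/orP=> /eqP-> //; rewrite eqxx.
  have iterE i : i <= m -> s i = iter i (succ W) (s 0).
    by elim: i => //= i IH im; rewrite step // IH // ltnW.
  case: (apW (s 0)); split.
    by have [iW _ _] := st 0 m0; apply/imsetP; exists (s 0, t 0).
  by exists m.-1; rewrite prednK // -iterE.
Qed.

(* Adding one arc to a rooted forest creates at most one cycle. *)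
Lemma morse_exchange S T F b : {in S &, injective fst} ->
  F \subset S -> b \in S -> b \notin F -> [disjoint F & T] ->
  F :|: T \in morse_simplices G -> b |: T \in morse_simplices G ->
  exists F', [/\ F' \subset F, #|F| <= #|F'|.+1
               & F' :|: (b |: T) \in morse_simplices G].
Proof.
move=> injS FS bS bF FT FTM bTM.
have neq0 (A : {set {set V} * {set V}}) : A :|: (b |: T) != set0.
  by apply/set0Pn; exists b; rewrite !inE eqxx orbT.
have FT0 : F :|: T != set0 by apply: contraTneq FTM => ->; exact: morse_neq0.
have bT0 : b |: T != set0 by apply: contraTneq bTM => ->; exact: morse_neq0.
have [prFT injFT apFT] := (morse_okP FT0).1 FTM.
have [prbT injbT apbT] := (morse_okP bT0).1 bTM.
pose U := F :|: (b |: T).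
have UE : U = b |: (F :|: T) by rewrite /U setUCA.
have FU : F :|: T \subset U by rewrite UE subsetUr.
have bTU : b |: T \subset U by exact: subsetUr.
have bFT e : e \in F :|: T -> e.1 = b.1 -> e = b.
  rewrite inE => /orP[eF|eT] eb.
    by apply: injS => //; exact: subsetP FS _ eF.
  by apply: injbT; rewrite // !inE ?eT ?eqxx ?orbT.
have injU : {in U &, injective fst}.
  move=> e e'; rewrite UE !in_setU1 => /predU1P[->|eF] /predU1P[->|e'F] ee' //.
  - by apply/esym/bFT => //; rewrite ee'.
  - by apply: bFT.
  - exact: injFT.
have prU : {in U, forall e, primitive_dvf G e}.
  move=> e; rewrite UE in_setU1 => /predU1P[->|]; last exact: prFT.
  by apply: prbT; rewrite !inE eqxx.
(* [F :|: T] has no cycle, so every cycle of [U] uses the arc [b]. *)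
have through s : periodic U s -> exists i, iter i (succ U) s = b.1.
  move=> ps; apply: contrapT => nb; apply: (apFT s).
  apply: (periodic_sub FU injU ps) => i.
  have /imsetP[e] := periodic_source i ps.
  rewrite {1}UE in_setU1 => /predU1P[-> ib|eF ->]; last exact: imset_f.
  by case: nb; exists i.
have [nper|/existsNP[s /contrapT ps]] := pselect (forall s, ~ periodic U s).
  by exists F; split=> //; apply/(morse_okP (neq0 _)).
have pb : periodic U b.1.
  by have [i <-] := through s ps; exact: periodic_iter.
(* [b |: T] has no cycle either, so the cycle through [b] uses some arc [f] of [F]; this is the arc
   to drop. *)
have [j [f fF fj]] : exists j, exists2 f, f \in F & iter j (succ U) b.1 = f.1.
  apply: contrapT => nf; apply: (apbT b.1).
  apply: (periodic_sub bTU injU pb) => j.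
  have /imsetP[e] := periodic_source j pb.
  rewrite inE => /orP[eF ej|eT ->]; last exact: imset_f.
  by case: nf; exists j, e.
exists (F :\ f); split; first exact: subD1set.
  by rewrite (cardsD1 f) fF.
apply/(morse_okP (neq0 _)).
have subU : F :\ f :|: (b |: T) \subset U by apply: setSU; exact: subD1set.
split.
- by move=> e /(subsetP subU)/prU.
- by move=> e e' /(subsetP subU) eU /(subsetP subU) e'U; exact: injU.
(* A remaining cycle would again pass through [b], hence follow the same orbit to the source of [f],
   whose outgoing arc is gone. *)
- move=> s' /(periodicS subU injU)[ps' orb].
  have [i ib] := through s' ps'.
  have := orb (j + i); rewrite iterD ib fj => /imsetP[e eU fe].
  have {fe} ef : f = e.
    by apply: injU fe; [rewrite inE fF|exact: subsetP subU _ eU].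
  move: eU; rewrite -ef !inE eqxx /= (disjointFr FT fF) orbF => /eqP fb.
  by move: bF; rewrite -fb fF.
Qed.

(* Each arc of [S] that is dropped is charged to a distinct arc of [T]: the one
   with the same source, or, for an arc on a cycle, the next arc of the cycle,
   which is in [T] because the centres of the stars are not sources of [S]. *)
Lemma morse_large S T : {in S, forall e, primitive_dvf G e} ->
  {in S &, injective fst} ->
  {in S &, forall e e', e.2 :\: e.1 != e'.1} ->
  T = set0 \/ T \in morse_simplices G -> [disjoint S & T] -> #|T| < #|S| ->
  exists F, [/\ F \subset S, #|S| <= #|F| + #|T|
              & F :|: T \in morse_simplices G].
Proof.
move=> prS injS starS Tor ST TS.
have [prT injT apT] : morse_ok T.
  case: Tor => [->|TM].
    by split=> [e|e e'|s [/imsetP[e]]]; rewrite inE.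
  by apply/morse_okP => //; apply: contraTneq TM => ->; exact: morse_neq0.
pose S1 := [set e in S | e.1 \notin sources T].
pose U := S1 :|: T.
have S1S : S1 \subset S by apply/subsetP => e; rewrite inE => /andP[].
have prU : {in U, forall e, primitive_dvf G e}.
  by move=> e; rewrite inE => /orP[/(subsetP S1S)|]; [exact: prS|exact: prT].
have injU : {in U &, injective fst}.
  move=> e e'; rewrite !inE => /orP[/andP[eS eT]|eT] /orP[/andP[e'S e'T]|e'T].
  - exact: injS.
  - by move=> ee'; rewrite ee' imset_f in eT.
  - by move=> ee'; rewrite -ee' imset_f in e'T.
  - exact: injT.
pose F := [set e in S1 | ~~ `[< periodic U e.1 >]].
have FS1 : F \subset S1 by apply/subsetP => e; rewrite inE => /andP[].
have FS : F \subset S by apply: subset_trans S1S.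
have FTU : F :|: T \subset U by exact: setSU.
pose h e := if e.1 \in sources T then e.1 else e.2 :\: e.1.
have SF e : e \in S :\: F -> e.1 \in sources T \/
    [/\ e.1 \notin sources T, e \in S1 & periodic U e.1].
  rewrite 3!inE; case: (boolP (e.1 \in sources T)) => [|eT]; first by left.
  rewrite andbT negb_and negbK andbC => /andP[eS].
  by rewrite eS /= => /asboolP pe; right; split; rewrite // inE eS.
have hT : {in S :\: F, forall e, h e \in sources T}.
  move=> e eSF; rewrite /h; case: ifPn => // neT.
  case: (SF e eSF) => [eT|[_ eS1 pe]]; first by rewrite eT in neT.
  have eU : e \in U by rewrite inE eS1.
  have := periodic_source 1 pe; rewrite /= succE //.
  case/imsetP => e'; rewrite inE => /orP[e'S1|e'T ->]; last exact: imset_f.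
  move=> ee'; have := starS e e' (subsetP S1S _ eS1) (subsetP S1S _ e'S1).
  by rewrite ee' eqxx.
have injh : {in S :\: F &, injective h}.
  move=> e e' eSF e'SF; rewrite /h.
  have eS : e \in S by case/setDP: eSF.
  have e'S : e' \in S by case/setDP: e'SF.
  case: (SF e eSF) => [->|[/negPf-> eS1 pe]];
    case: (SF e' e'SF) => [->|[/negPf-> e'S1 pe']].
  - exact: injS.
  - by move/esym/eqP; rewrite (negPf (starS _ _ e'S eS)).
  - by move/eqP; rewrite (negPf (starS _ _ eS e'S)).
  - rewrite -(succE injU) -?(succE injU); try by rewrite inE ?eS1 ?e'S1.
    by move/(succ_periodic_inj pe pe')/injS; exact.
have cSF : #|S :\: F| <= #|T|.
  rewrite -(card_in_imset injh); apply: leq_trans (leq_imset_card fst T).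
  by apply/subset_leq_card/subsetP => s /imsetP[e /hT hs ->].
have cS : #|S| <= #|F| + #|T|.
  by rewrite -(cardsID F S) (setIidPr FS) leq_add2l.
exists F; split=> //.
have FT0 : F :|: T != set0.
  case: (set_0Vmem F) cS => [->|[e eF] _].
    by rewrite cards0 add0n leqNgt TS.
  by apply/set0Pn; exists e; rewrite inE eF.
apply/(morse_okP FT0); split.
- by move=> e /(subsetP FTU)/prU.
- by move=> e e' /(subsetP FTU) eU /(subsetP FTU) e'U; exact: injU.
(* A cycle here is also one of [U]; arcs of [F] lie on no such cycle, so it would consist of arcs of
   [T] alone. *)
- move=> s ps; have [psU orb] := periodicS FTU injU ps.
  apply: (apT s); apply: (periodic_sub (subsetUr S1 T) injU psU) => i.
  have /imsetP[e] := orb i; rewrite inE => /orP[eF ei|eT ->].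
    by move: eF; rewrite inE -ei => /andP[_ /asboolP[]]; exact: periodic_iter.
  exact: imset_f.
Qed.

(** The hypotheses on [S] describe disjoint stars directed towards their centres. *)
Lemma build_morse S d : {in S, forall e, primitive_dvf G e} ->
  {in S &, injective fst} -> {in S &, forall e e', e.2 :\: e.1 != e'.1} ->
  d < #|S| -> build d (morse_simplices G).
Proof.
move=> prS injS starS dS.
have cM : complex (morse_simplices G).
  split; first exact: morse_neq0.
  by move=> W U WM UW U0; exact: morse_face WM UW U0.
apply: (build_criterion cM (S := S)) dS => T.
  by move=> F b; exact: morse_exchange.
exact: morse_large.
Qed.

End MorseGraph.

(** * Star forests in a graph *)

Section StarForest.
Context {V : finType} (G : scomplex V).
Implicit Types (R : {set V}) (x y c : V) (d : nat) (s : {set V}).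

Definition adj x y := (x != y) && ([set x; y] \in G).

Lemma adj_sym x y : adj x y = adj y x.
Proof. by rewrite /adj eq_sym setUC. Qed.

Lemma adj_primitive x y : adj x y -> primitive_dvf G ([set x], [set x; y]).
Proof.
case/andP=> xy xyG; apply/and4P; split=> //=.
- apply: (simplices_face xyG); first by rewrite sub1set !inE eqxx.
  by rewrite -card_gt0 cards1.
- by rewrite /Defs.dim cards1 cards2 xy.
- by rewrite properE subsetUl subUset !sub1set !inE eqxx eq_sym (negPf xy).
Qed.

Lemma edgeP s : s \in edges G -> exists x y, adj x y /\ s = [set x; y].
Proof.
rewrite inE => /andP[sG]; rewrite /Defs.dim => ds.
have /cards2P[x [y [xy sE]]] : #|s| == 2 by move: ds; case: #|s| => [|[|[]]].
by exists x, y; rewrite /adj xy -sE.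
Qed.

Lemma star_build (hG : is_graph G) R (p : V -> V) d :
  {in R, forall x, adj x (p x)} -> {in R, forall x, p x \notin R} ->
  d < #|R| -> build d (morse_simplices G).
Proof.
move=> adjp pR dR; pose a x : {set V} * {set V} := ([set x], [set x; p x]).
have inja : injective a by move=> x y [] /set1_inj.
apply: (build_morse hG (S := a @: R)).
- by move=> _ /imsetP[x /adjp xp ->]; exact: adj_primitive.
- by move=> _ _ /imsetP[x xR ->] /imsetP[y yR ->] /set1_inj ->.
- move=> _ _ /imsetP[x xR ->] /imsetP[y yR ->] /=.
  rewrite pair_setD; last by case/andP: (adjp x xR).
  by apply: contraNneq (pR x xR) => /set1_inj ->.
- by rewrite card_imset.
Qed.

Lemma sum_degrees : \sum_x #|[set s in edges G | x \in s]| = 2 * #|edges G|.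
Proof.
transitivity (\sum_x \sum_(s in edges G) (x \in s)).
  apply: eq_bigr => x _; rewrite -big_mkcondr /= -sum1_card.
  by apply: eq_bigl => s; rewrite inE.
rewrite exchange_big /= mulnC -sum_nat_const; apply: eq_bigr => s sE.
have [x [y [/andP[xy _] ->]]] := edgeP sE.
by rewrite -big_mkcond /= sum1_card cards2 xy.
Qed.

Lemma build_graph (hG : is_graph G) d : d ^ 2 < #|edges G| ->
  build d (morse_simplices G).
Proof.
move=> dE; pose deg x := #|[set s in edges G | x \in s]|.
have [[c dc]|smalldeg] := pselect (exists c, d < deg c).
  apply: (@star_build hG [set y | adj y c] (fun=> c)).
  - by move=> x; rewrite inE.
  - by move=> x _; rewrite inE /adj eqxx.
  - apply: leq_trans dc _.
    apply: leq_trans (leq_imset_card (fun y => [set y; c]) _).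
    apply/subset_leq_card/subsetP => s; rewrite inE => /andP[].
    move=> /edgeP[x [y [xy ->]]]; rewrite !inE => /orP[]/eqP cE.
      by apply/imsetP; exists y; rewrite cE ?inE 1?adj_sym // setUC.
    by apply/imsetP; exists x; rewrite cE ?inE.
have {}smalldeg x : deg x <= d.
  by rewrite leqNgt; apply/negP => dx; apply: smalldeg; exists x.
pose N := [set x | [exists y, adj x y]].
(* Counting degrees, [2 * d ^ 2 < 2 * #|edges G| <= #|N| * d]. *)
have big : 2 * d < #|N|.
  have : 2 * #|edges G| <= #|N| * d.
    rewrite -sum_degrees (bigID [in N]) /= [X in _ + X]big1 ?addn0.
      by rewrite -sum_nat_const; apply: leq_sum => x _; exact: smalldeg.
    move=> x; rewrite inE => xN; apply: eq_card0 => s; rewrite !inE.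
    apply/negbTE/negP => /andP[/andP[sG ds] xs]; case/negP: xN.
    have /edgeP[y [z [yz sE]]] : s \in edges G by rewrite inE sG.
    move: xs; rewrite sE !inE => /orP[]/eqP->; apply/existsP.
      by exists z.
    by exists y; rewrite adj_sym.
  by move: dE; rewrite expnS expn1; nia.
pose indep (I : {set V}) :=
  (I \subset N) && [forall x in I, forall y in I, ~~ adj x y].
have [|I maxI _] := @maxset_exists _ indep set0.
  by rewrite /indep sub0set; apply/forall_inP => x; rewrite inE.
have /andP[IN /forall_inP indI] := maxsetp maxI.
pose p x := odflt x [pick y | adj x y].
have adjp x : x \in N -> adj x (p x).
  rewrite inE /p => /existsP[y xy]; case: pickP => [//|/(_ y)].
  by rewrite xy.
have [dI|Id] := ltnP d #|I|.
  apply: (@star_build hG I p) => // x xI; first exact/adjp/(subsetP IN).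
  apply/negP => pI; have /forall_inP/(_ _ pI)/negP := indI _ xI; apply.
  exact/adjp/(subsetP IN).
(* Otherwise the complement has more than [d] vertices, and by maximality of [I] each of them has a
   neighbour in [I] to serve as its centre. *)
pose q x := odflt x [pick y | (y \in I) && adj x y].
have qP x : x \in N :\: I -> (q x \in I) && adj x (q x).
  case/setDP => xN xI; rewrite /q; case: pickP => [//|noI].
  have : I = x |: I.
    apply/esym/(maxsetsup maxI); last exact: subsetUr.
    rewrite /indep subUset sub1set xN IN /=.
    apply/forall_inP => y yI; apply/forall_inP => z zI.
    move: yI zI; rewrite !in_setU1 => /predU1P[->|yI] /predU1P[->|zI].
    - by rewrite /adj eqxx.
    - by have := noI z; rewrite zI /= => ->.
    - by have := noI y; rewrite yI adj_sym /= => ->.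
    - by have /forall_inP := indI _ yI; apply.
  by move=> IE; rewrite IE !inE eqxx in xI.
apply: (@star_build hG (N :\: I) q).
- by move=> x /qP/andP[].
- by move=> x /qP/andP[qI _]; rewrite inE qI.
- have := cardsID I N; rewrite (setIidPr IN); lia.
Qed.

End StarForest.

From mathcomp Require Import all_classical all_reals all_analysis.
From mathcomp Require Import lra ring.
Import Order.TTheory GRing.Theory Num.Theory.
Import numFieldTopology.Exports numFieldNormedType.Exports.
Local Open Scope classical_set_scope.
Local Open Scope ring_scope.

(** * Filling spheres in realizations *)

Section Lipschitz.
Context {R : realType} {E : normedModType R}.

Definition sphere : set E := [set u | `|u| = 1].
Definition disk : set E := [set u | `|u| <= 1].

Definition lip (f : E -> R) :=
  exists2 C, 0 <= C &
    forall u w, sphere u -> sphere w -> `|f u - f w| <= C * `|u - w|.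

Lemma lip_ext f g : (forall u, sphere u -> f u = g u) -> lip g -> lip f.
Proof.
by move=> fg [C C0 gC]; exists C => // u w Su Sw; rewrite !fg //; exact: gC.
Qed.

Lemma lip_cst a : lip (fun=> a).
Proof. by exists 0 => // u w _ _; rewrite subrr normr0 mul0r. Qed.

Lemma lipD f g : lip f -> lip g -> lip (fun u => f u + g u).
Proof.
move=> [C C0 fC] [D D0 gD]; exists (C + D) => [|u w Su Sw].
  exact: addr_ge0.
rewrite opprD addrACA mulrDl; apply: le_trans (ler_normD _ _) _.
by apply: lerD; [exact: fC|exact: gD].
Qed.

Lemma lipN f : lip f -> lip (fun u => - f u).
Proof.
by move=> [C C0 fC]; exists C => // u w Su Sw; rewrite -opprD normrN; exact: fC.
Qed.

Lemma lipB f g : lip f -> lip g -> lip (fun u => f u - g u).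
Proof. by move=> lf lg; apply: lipD => //; exact: lipN. Qed.

Lemma lip_bounded f : lip f ->
  exists2 B, 0 <= B & forall u, sphere u -> `|f u| <= B.
Proof.
move=> [C C0 fC]; have [[w Sw]|nS] := pselect (exists w, sphere w); last first.
  by exists 0 => // u Su; case: nS; exists u.
exists (`|f w| + C * 2) => [|u Su]; first by rewrite addr_ge0 // mulr_ge0.
rewrite -[f u](subrK (f w)) addrC; apply: le_trans (ler_normD _ _) _.
apply: lerD => //; apply: le_trans (fC _ _ Su Sw) _.
apply: ler_wpM2l => //; apply: le_trans (ler_normB _ _) _.
by rewrite Su Sw.
Qed.

Lemma lipM f g : lip f -> lip g -> lip (fun u => f u * g u).
Proof.
move=> lf lg.
have [A A0 fA] := lip_bounded lf; have [B B0 gB] := lip_bounded lg.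
case: lf lg => C C0 fC [D D0 gD]; exists (C * B + A * D).
  by rewrite addr_ge0 // mulr_ge0.
move=> u w Su Sw.
have -> : f u * g u - f w * g w = (f u - f w) * g u + f w * (g u - g w) by ring.
apply: le_trans (ler_normD _ _) _; rewrite !normrM mulrDl; apply: lerD.
  rewrite mulrAC; apply: ler_pM => //; [exact: fC|exact: gB].
by rewrite -mulrA; apply: ler_pM => //; [exact: fA|exact: gD].
Qed.

Lemma lip_min f g : lip f -> lip g -> lip (fun u => Num.min (f u) (g u)).
Proof.
move=> [C C0 fC] [D D0 gD]; exists (C + D) => [|u w Su Sw].
  exact: addr_ge0.
have := fC u w Su Sw; have := gD u w Su Sw.
have := mulr_ge0 C0 (normr_ge0 (u - w)).
have := mulr_ge0 D0 (normr_ge0 (u - w)).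
rewrite mulrDl !ler_norml.
by case: (leP (f u) (g u)); case: (leP (f w) (g w)); lra.
Qed.

Lemma lip_max f g : lip f -> lip g -> lip (fun u => Num.max (f u) (g u)).
Proof.
move=> lf lg; apply: (@lip_ext _ (fun u => - Num.min (- f u) (- g u))).
  by move=> u _; rewrite oppr_min !opprK.
by apply/lipN/lip_min; exact: lipN.
Qed.

Lemma lip_inv f e : 0 < e -> (forall u, sphere u -> e <= f u) -> lip f ->
  lip (fun u => (f u)^-1).
Proof.
move=> e0 ef [C C0 fC]; exists (C * (e^-1 * e^-1)) => [|u w Su Sw].
  by rewrite !mulr_ge0 // invr_ge0 ltW.
have fu : 0 < f u by apply: lt_le_trans (ef u Su).
have fw : 0 < f w by apply: lt_le_trans (ef w Sw).
have -> : (f u)^-1 - (f w)^-1 = (f w - f u) * ((f u)^-1 * (f w)^-1).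
  by field; rewrite !gt_eqF.
rewrite normrM distrC [X in _ * X]ger0_norm; last first.
  by rewrite mulr_ge0 // invr_ge0 ltW.
rewrite mulrAC; apply: ler_pM => //; first by rewrite mulr_ge0 // invr_ge0 ltW.
  exact: fC.
by apply: ler_pM; rewrite ?invr_ge0 ?lef_pV2 ?posrE ?ef // ltW.
Qed.

Lemma lip_sum (I : Type) (r : seq I) (p : pred I) (f : I -> E -> R) :
  (forall i, lip (f i)) -> lip (fun u => \sum_(i <- r | p i) f i u).
Proof.
move=> lf; elim: r => [|i r IH].
  by apply: lip_ext (lip_cst 0) => u _; rewrite big_nil.
case pi: (p i); last by apply: lip_ext IH => u _; rewrite big_cons pi.
by apply: lip_ext (lipD (lf i) IH) => u _; rewrite big_cons pi.
Qed.

Lemma lip_bigmin (I : Type) (r : seq I) (p : pred I) (f : I -> E -> R) g :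
  lip g -> (forall i, lip (f i)) ->
  lip (fun u => \big[Num.min/g u]_(i <- r | p i) f i u).
Proof.
move=> lg lf; elim: r => [|i r IH].
  by apply: lip_ext lg => u _; rewrite big_nil.
case pi: (p i); last by apply: lip_ext IH => u _; rewrite big_cons pi.
by apply: lip_ext (lip_min (lf i) IH) => u _; rewrite big_cons pi.
Qed.

Lemma lip_uniform (I : finType) (f : I -> E -> R) : (forall i, lip (f i)) ->
  exists2 C, 0 <= C & forall i u w, sphere u -> sphere w ->
    `|f i u - f i w| <= C * `|u - w|.
Proof.
move=> lf; have lfC i : exists C, 0 <= C /\ forall u w, sphere u -> sphere w ->
    `|f i u - f i w| <= C * `|u - w|.
  by have [C C0 fC] := lf i; exists C.
have [C CP] := choice lfC.
exists (\sum_i C i) => [|i u w Su Sw].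
  by apply: sumr_ge0 => i _; case: (CP i).
apply: le_trans ((CP i).2 u w Su Sw) _; apply: ler_wpM2r => //.
by rewrite (bigD1 i) //= lerDl; apply: sumr_ge0 => j _; case: (CP j).
Qed.

Lemma lip_continuous f : lip f -> {within sphere, continuous f}.
Proof.
move=> [C C0 fC]; apply/subspace_continuousP => u Su.
apply/cvgrPdist_le => e e0; rewrite /within /=.
have Ce : 0 < e / (C + 1) by rewrite divr_gt0 // ltr_wpDl.
have := @nbhsx_ballx _ _ u _ Ce; apply: filterS => w.
rewrite -ball_normE /= => uw Sw; apply: le_trans (fC _ _ Su Sw) _.
apply: (@le_trans _ _ (C * (e / (C + 1)))).
  by apply: ler_wpM2l => //; exact: ltW.
rewrite mulrA ler_pdivrMr ?ltr_wpDl // mulrC ler_wpM2l //; first exact: ltW.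
by rewrite lerDl.
Qed.

Lemma compact_uniform (A : set E) (f : E -> R) e : compact A ->
  {within A, continuous f} -> 0 < e ->
  exists2 d, 0 < d & forall u w, A u -> A w -> `|u - w| < d -> `|f u - f w| < e.
Proof.
move=> cA /subspace_continuousP cf e0.
pose Q (d : R) u := A u -> forall w, A w -> `|u - w| < d -> `|f u - f w| < e.
have : \forall d \near (0 : R)^'+, (A `<=` Q d).
  apply: (iffLR (compact_near_coveringP A)) => // u Au.
  have e20 : 0 < e / 2 by rewrite divr_gt0.
  have /cvgrPdist_lt/(_ _ e20) := cf u Au.
  rewrite /within /= => /nbhs_ballP[d /= d0 ballP].
  have d20 : 0 < d / 2 by rewrite divr_gt0.
  exists (ball u (d / 2), [set x : R | 0 < x < d / 2]) => /=.
    split; first exact: nbhsx_ballx.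
    near=> x; apply/andP; split=> //.
  move=> [u' x] /= [uu' /andP[x0 xd]] Au' w Aw u'w.
  move: uu'; rewrite -ball_normE /= => uu'.
  have H1 : `|f u - f u'| < e / 2.
    by apply: ballP => //; rewrite -ball_normE /=; apply: lt_trans uu' _; lra.
  have H2 : `|f u - f w| < e / 2.
    apply: ballP => //; rewrite -ball_normE /=.
    by have := ler_distD u' u w; lra.
  have := ler_distD (f u) (f u') (f w); rewrite [`|f u' - f u|]distrC; lra.
move=> H; near ((0 : R)^'+) => d; exists d => //.
have : (A `<=` Q d) by near: d.
by move=> AQ u w Au Aw; exact: AQ.
Unshelve. all: by end_near.
Qed.

(** The inf-convolution of [f] with [L * |u - w|] is [L]-Lipschitz and lies below [f]. With
    [L = 1 / d] for a modulus of continuity [d], points at distance at least [d] from [u] contribute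
    at least [1 >= f u], and nearer points at least [f u - e]. *)
Lemma lip_approx (f : E -> R) e : compact sphere ->
  {within sphere, continuous f} -> (forall u, sphere u -> 0 <= f u <= 1) ->
  0 < e -> exists2 g, lip g & forall u, sphere u -> f u - e <= g u <= f u.
Proof.
move=> cS cf f01 e0; have [d d0 dP] := compact_uniform cS cf e0.
pose L := d^-1; have L0 : 0 <= L by rewrite invr_ge0 ltW.
pose S u := [set f w + L * `|u - w| | w in sphere].
have lbS u : has_lbound (S u).
  exists 0 => _ [w Sw <-]; rewrite addr_ge0 //; first by case/andP: (f01 w Sw).
  by rewrite mulr_ge0.
pose g u := inf (S u); exists g.
  suff half u w : sphere u -> sphere w -> g u <= g w + L * `|u - w|.
    exists L => // u w Su Sw; rewrite ler_norml lerBlDl.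
    have := half _ _ Su Sw; have := half _ _ Sw Su; rewrite distrC; lra.
  move=> Su Sw; rewrite -lerBlDr; apply: lb_le_inf.
    by exists (f w + L * `|w - w|), w.
  move=> _ [z Sz <-]; rewrite lerBlDr.
  apply: le_trans (_ : f z + L * `|u - z| <= _).
    by apply: ge_inf => //; exists z.
  rewrite -addrA lerD2l -mulrDr ler_wpM2l // [leRHS]addrC; exact: ler_distD.
move=> u Su; apply/andP; split; last first.
  by apply: ge_inf => //; exists u; rewrite // subrr normr0 mulr0 addr0.
apply: lb_le_inf; first by exists (f u + L * `|u - u|), u.
move=> _ [w Sw <-]; have [uw|uw] := ltP `|u - w| d.
  have := dP _ _ Su Sw uw; have := mulr_ge0 L0 (normr_ge0 (u - w)).
  by rewrite ltr_norml; lra.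
have : 1 <= L * `|u - w| by rewrite -(mulVf (lt0r_neq0 d0)) ler_wpM2l.
have /andP[] := f01 _ Su; have /andP[] := f01 _ Sw; lra.
Qed.

End Lipschitz.

(** * Barycentric coordinates *)

Section Barycentric.
Context {R : realType} {P : finType}.
Implicit Types (K : {set {set P}}) (s t : {set P}) (x y : P -> R) (v w : P).

Definition bary s x :=
  [/\ forall v, 0 <= x v, \sum_v x v = 1 & forall v, v \notin s -> x v = 0].

Definition supp x : {set P} := [set v | x v != 0]%SET.

Definition geom K : set (P -> R) :=
  [set x | [/\ forall v, 0 <= x v, \sum_v x v = 1 & supp x \in K]].

Lemma bary_supp x : (forall v, 0 <= x v) -> \sum_v x v = 1 -> bary (supp x) x.
Proof. by move=> x0 x1; split=> // v; rewrite inE negbK => /eqP. Qed.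

Lemma geomP K x : complex K -> geom K x <-> exists2 s, s \in K & bary s x.
Proof.
move=> [_ cK]; split=> [[x0 x1 xK]|[s sK [x0 x1 xs]]].
  by exists (supp x) => //; exact: bary_supp.
split=> //; apply: cK sK _ _.
  by apply/fintype.subsetP => v; rewrite inE; apply: contraR => /xs ->.
apply/eqP => sx0; move: x1; rewrite big1 ?(@eqP _ 0 1) => [/esym/eqP|v _].
  by rewrite oner_eq0.
apply/eqP/negPn/negP => xv; have : v \in supp x by rewrite inE.
by rewrite sx0 inE.
Qed.

Lemma bary_sub s t x : s \subset t -> bary s x -> bary t x.
Proof.
move=> /fintype.subsetP st [x0 x1 xs]; split=> // v vt; apply: xs.
by apply: contra vt; exact: st.
Qed.

Lemma bary_conv s x y (r : R) : 0 <= r <= 1 -> bary s x -> bary s y ->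
  bary s (fun v => (1 - r) * x v + r * y v).
Proof.
case/andP=> r0 r1 [x0 x1 xs] [y0 y1 ys]; split=> [v||v vs].
- by rewrite addr_ge0 // mulr_ge0 // subr_ge0.
- by rewrite big_split /= -!mulr_sumr x1 y1 !mulr1 subrK.
- by rewrite xs // ys // !mulr0 addr0.
Qed.

Lemma bary_le1 s x v : bary s x -> x v <= 1.
Proof.
by move=> [x0 x1 _]; rewrite -x1 (bigD1 v) //= lerDl; apply: sumr_ge0.
Qed.

Lemma minimum_attained s (f : P -> R) v : v \in s ->
  exists2 w, w \in s & \big[Num.min/f v]_(w in s) f w = f w.
Proof.
move=> vs; apply: (big_ind (fun z => exists2 w, w \in s & z = f w)).
- by exists v.
- by move=> _ _ [a aS ->] [b bS ->]; case: leP => _; [exists a|exists b].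
- by move=> w ws; exists w.
Qed.

End Barycentric.

Lemma within_continuous_compose (T U W : topologicalType) (A : set T)
    (C : set U) (g : T -> U) (f : U -> W) :
  {within A, continuous g} -> (forall x, A x -> C (g x)) ->
  {within C, continuous f} -> {within A, continuous (f \o g)}.
Proof.
move=> /subspace_continuousP cg gAC /subspace_continuousP cf.
apply/subspace_continuousP => x Ax.
apply: cvg_comp (cf (g x) (gAC x Ax)) => Q.
rewrite /within /= => H; have := cg x Ax _ H.
rewrite !nbhs_simpl /within /=; apply: filterS => y gy Ay.
by apply: gy => //; exact: gAC.
Qed.

Lemma within_continuous_eq (T U : topologicalType) (A : set T) (f g : T -> U) :
  (forall x, A x -> f x = g x) -> {within A, continuous f} ->
  {within A, continuous g}.
Proof.
by move=> fg; apply: subspace_eq_continuous => x; rewrite inE; exact: fg.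
Qed.

(** * Extending maps from the sphere to the disk *)

Section Extension.
Context {R : realType} {P : finType} (E : normedModType R).
Implicit Types (K : {set {set P}}) (s t : {set P}) (X : set (P -> R)).
Implicit Types (phi psi : E -> P -> R).

Definition extendable X phi := exists psi,
  [/\ forall v, {within disk, continuous (fun u => psi u v)},
      forall u, disk u -> X (psi u)
    & forall u, sphere u -> psi u = phi u].

Lemma closed_norm_le (r : R) : closed [set u : E | `|u| <= r].
Proof.
apply: (@closed_comp _ _ (fun u : E => `|u|) [set x : R | x <= r]).
  by move=> u _; exact: norm_continuous.
exact: closed_le.
Qed.

Lemma closed_norm_ge (r : R) : closed [set u : E | r <= `|u|].
Proof.
apply: (@closed_comp _ _ (fun u : E => `|u|) [set x : R | r <= x]).
  by move=> u _; exact: norm_continuous.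
exact: closed_ge.
Qed.

(* The extension of [phi'] is shrunk to the disk of radius 1/2; the homotopy
   fills the remaining collar. *)
Lemma extend_homotopy X phi phi' :
  (forall v, {within sphere, continuous (fun u => phi u v)}) ->
  (forall v, {within sphere, continuous (fun u => phi' u v)}) ->
  (forall u (r : R), sphere u -> 0 <= r <= 1 ->
     X (fun v => (1 - r) * phi' u v + r * phi u v)) ->
  extendable X phi' -> extendable X phi.
Proof.
move=> cphi cphi' hX [psi [cpsi psiX psiE]].
(* The weight [2 * |u| - 1] grows from 0 at radius 1/2, where the values are those of [phi'], to 1
   on the sphere, where they are those of [phi]. *)
pose col (u : E) (v : P) : R := (1 - (2 * `|u| - 1)) * phi' (`|u|^-1 *: u) v
                      + (2 * `|u| - 1) * phi (`|u|^-1 *: u) v.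
pose Psi (u : E) := if `|u| <= 2^-1 then psi (2 *: u) else col u.
pose A : set E := [set u | `|u| <= 2^-1].
pose B : set E := [set u | 2^-1 <= `|u|] `&` disk.
have half0 : 0 < 2^-1 :> R by rewrite invr_gt0.
have diskE : disk = A `|` B.
  apply/seteqP; split=> u /=; rewrite /disk /A /B /=.
    by move=> u1; have [|/ltW] := leP `|u| 2^-1; [left|right].
  by case=> [|[]//] => u2; apply: le_trans u2 _; rewrite invf_le1 ?ler1n.
have normed (u : E) : u != 0 -> sphere (`|u|^-1 *: u).
  move=> u0; rewrite /sphere /= normrZ ger0_norm ?invr_ge0 //.
  by rewrite mulVf // normr_eq0.
have B0 u : B u -> u != 0.
  by case=> /= u2 _; rewrite -normr_gt0; apply: lt_le_trans u2.
have psi_col (u : E) : `|u| = 2^-1 -> psi (2 *: u) = col u.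
  move=> u2; rewrite /col u2 invrK psiE; last first.
    by rewrite /sphere /= normrZ u2 ger0_norm // divff ?pnatr_eq0.
  apply/funext => v.
  by rewrite divff ?pnatr_eq0 // subrr subr0 mul0r addr0 mul1r.
exists Psi; split.
- move=> v; rewrite diskE; apply: withinU_continuous.
  + exact: closed_norm_le.
  + by apply: closedI; [exact: closed_norm_ge|exact: closed_norm_le].
  + apply: (within_continuous_eq (f := (psi^~ v) \o (fun u => 2 *: u))).
      by move=> u u2; rewrite /Psi ifT.
    apply: (within_continuous_compose (C := disk)) (cpsi v).
      by apply: continuous_subspaceT => u; exact: scaler_continuous.
    by move=> u; rewrite /A /disk /= normrZ ger0_norm // -ler_pdivlMl // mulr1.
  + apply: (within_continuous_eq (f := col^~ v)).
      move=> u [u2 _]; rewrite /Psi; case: ifPn => // u2'; rewrite psi_col //.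
      by apply/eqP; rewrite eq_le u2 u2'.
    have cn : {within B, continuous (fun u : E => `|u|)}.
      by apply: continuous_subspaceT; exact: norm_continuous.
    have cd : {within B, continuous (fun u : E => 2 * `|u| - 1)}.
      move=> u; apply: cvgB; last exact: cvg_cst.
      by apply: cvgM; [exact: cvg_cst|exact: cn].
    have cu : {within B, continuous (fun u : E => `|u|^-1 *: u)}.
      apply: continuous_in_subspaceT => u; rewrite inE => /B0 u0.
      apply: cvgZ; last exact: cvg_id.
      by apply: cvgV; [rewrite normr_eq0|exact: norm_continuous].
    have comp (f : E -> P -> R) : {within sphere, continuous (f^~ v)} ->
        {within B, continuous (fun u => f (`|u|^-1 *: u) v)}.
      move=> cf; apply: (within_continuous_compose cu _ cf).
      by move=> u /B0; exact: normed.
    move=> u; apply: cvgD; apply: cvgM.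
    * by apply: cvgB; [exact: cvg_cst|exact: cd].
    * exact: comp.
    * exact: cd.
    * exact: comp.
- move=> u; rewrite /Psi /disk /= => u1; case: ifPn => [u2|].
    by apply: psiX; rewrite /disk /= normrZ ger0_norm // -ler_pdivlMl // mulr1.
  rewrite -ltNge => u2; apply: hX.
    by apply: normed; rewrite -normr_gt0; lra.
  by apply/andP; split; lra.
- move=> u; rewrite /sphere /Psi /= => u1; rewrite u1 ifF; last first.
    by apply/negbTE; rewrite -ltNge invf_lt1 ?ltr1n.
  apply/funext => v; rewrite /col u1 invr1 scale1r; ring.
Qed.
End Extension.

(** * Filling Lipschitz spheres *)

Section Filling.
Context {R : realType} {P : finType} (E : normedModType R).
Implicit Types (K : {set {set P}}) (s t : {set P}) (v w : P) (x p : P -> R).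
Implicit Types (phi : E -> P -> R).

(** Restricted to Lipschitz maps, since attaching a simplex requires the sphere to miss a
    neighbourhood of a point; [fillable_continuous] passes to continuous maps by approximation. *)
Definition fillable K := forall phi, (forall v, lip (phi^~ v)) ->
  (forall u, sphere u -> geom K (phi u)) -> extendable (geom K) phi.

Lemma fillable_vertex v : fillable [set [set v]]%SET.
Proof.
move=> phi _ phiK.
have point u : sphere u -> phi u = fun w => (w == v)%:R.
  move=> /phiK[phi0 phi1]; rewrite inE => /eqP sv.
  have off w : w != v -> phi u w = 0.
    move=> wv; apply/eqP/negPn/negP => xw.
    have : w \in supp (phi u) by rewrite inE.
    by rewrite sv inE (negPf wv).
  apply/funext => w; have [->|/off//] := eqVneq w v.
  by rewrite -phi1 (bigD1 v) //= big1 ?addr0 // => w' /off.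
exists (fun _ w => (w == v)%:R); split.
- by move=> w; apply: continuous_subspaceT => u; exact: cvg_cst.
- move=> u _; split=> [w||]; first exact: ler0n.
    rewrite (bigD1 v) //= eqxx big1 ?addr0 // => w /negPf wv.
    by rewrite wv.
  rewrite inE; apply/eqP/setP => w; rewrite !inE.
  by rewrite pnatr_eq0 eqb0 negbK.
- by move=> u /point.
Qed.

(** [phi] and its retraction share a simplex [t'] of [K'], so the segments between them stay in the
    realization of [K']; after this homotopy the map lies in that of [K], where it can be filled. *)
Lemma fillable_retract K K' phi (r : (P -> R) -> P -> R) :
  complex K -> complex K' -> K \subset K' -> fillable K ->
  (forall v, lip (phi^~ v)) -> (forall v, lip (fun u => r (phi u) v)) ->
  (forall u, sphere u -> exists t t', [/\ t \in K, t' \in K', t \subset t',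
     bary t (r (phi u)) & bary t' (phi u)]) ->
  extendable (geom K') phi.
Proof.
move=> cK cK' /fintype.subsetP KK' fK lphi lr rP.
apply: (extend_homotopy (phi' := fun u => r (phi u))).
- by move=> v; exact: lip_continuous.
- by move=> v; exact: lip_continuous (lr v).
- move=> u a Su a01; have [t [t' [tK t'K' tt' bt bt']]] := rP u Su.
  apply/(geomP _ cK'); exists t' => //; apply: bary_conv => //.
  exact: bary_sub bt.
- have [|psi [cpsi psiK psiE]] := fK (fun u => r (phi u)) lr.
    move=> u Su; have [t [t' [tK _ _ bt _]]] := rP u Su.
    by apply/(geomP _ cK); exists t.
  exists psi; split=> // u Du; have [y0 y1 yK] := psiK u Du.
  by split=> //; exact: KK'.
Qed.

(* Subtracting the smallest coordinate on the free face [s] from all of them,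
   and giving the mass so removed to [v], retracts onto [K]. *)
Lemma fillable_expand K s v : complex K ->
  complex ([set s; v |: s] :|: K)%SET ->
  s != finset.set0 -> s \notin K -> v \notin s ->
  (forall t, t \subset (v |: s)%SET -> t != finset.set0 -> t != s ->
     t != (v |: s)%SET -> t \in K) ->
  fillable K -> fillable ([set s; v |: s] :|: K)%SET.
Proof.
move=> cK cK' s0 sK vs fs fK phi lphi phiK'.
have /finset.set0Pn[w1 w1s] := s0.
pose m x := \big[Num.min/x w1]_(w in s) x w.
pose r x w := x w - m x * (w \in s)%:R + m x * (#|s|%:R * (w == v)%:R).
have lm : lip (fun u => m (phi u)) by exact: lip_bigmin.
apply: (fillable_retract (r := r) cK cK') => //.
- exact: finset.subsetUr.
- move=> w; apply: lipD; last by apply: lipM => //; exact: lip_cst.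
  by apply: lipB => //; apply: lipM => //; exact: lip_cst.
move=> u Su; have [x0 x1] := phiK' u Su; set x := phi u in x0 x1 *.
set s1 := supp x => s1K'; have bs1 : bary s1 x by exact: bary_supp.
have mle w : w \in s -> m x <= x w by move=> ws; exact: bigmin_le_cond.
have [w0 w0s mE] := minimum_attained x w1s; rewrite -/(m x) in mE.
(* If some vertex of [s] is missing from the support, [m x] is zero and [r] fixes [x], which already
   lies in [K]. *)
have [ss1|] := boolP (s \subset s1); last first.
  case/fintype.subsetPn => w ws; rewrite inE negbK => /eqP xw.
  have m0 : m x = 0 by apply/eqP; rewrite eq_le -{1}xw mle // mE x0.
  exists s1, s1; split=> //.
    move: s1K'; rewrite !inE => /orP[/orP[]/eqP sE|//].
      have : w \in s1 by rewrite sE.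
      by rewrite inE xw eqxx.
    have : w \in s1 by rewrite sE !inE ws orbT.
    by rewrite inE xw eqxx.
  suff -> : r x = x by [].
  by apply/funext => w'; rewrite /r m0 !mul0r subr0 addr0.
have vw0 : v != w0 by apply: contraNneq (vs) => ->.
(* The coordinate at the minimizer [w0] becomes zero, so [r x] lies in the facet opposite [w0]; this
   facet contains [v] but not [w0], hence is neither [s] nor [v |: s]. *)
exists ((v |: s) :\ w0)%SET, (v |: s)%SET; split.
- apply: fs; first exact: subD1set.
  + by apply/finset.set0Pn; exists v; rewrite !inE eqxx vw0.
  + by apply: contraNneq (vs) => <-; rewrite !inE eqxx vw0.
  + by apply/eqP => /setP/(_ w0); rewrite !inE eqxx w0s orbT.
- by rewrite !inE eqxx orbT.
- exact: subD1set.
- split=> [w||w].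
  + rewrite /r; have m0 : 0 <= m x by rewrite mE.
    apply: addr_ge0; last by rewrite !mulr_ge0.
    case: (boolP (w \in s)) => [/mle|_];
      by rewrite ?mulr1 ?mulr0 ?subr0 ?subr_ge0.
  + rewrite /r big_split sumrB /= x1 -!mulr_sumr.
    have -> : \sum_w (w \in s)%:R = #|s|%:R :> R.
      by rewrite -natr_sum -big_mkcond /= sum1_card.
    have -> : \sum_w (w == v)%:R = 1 :> R.
      by rewrite (bigD1 v) //= eqxx big1 ?addr0 // => w /negPf->.
    by rewrite mulr1 subrK.
  + rewrite !inE negb_and negbK negb_or /r => /orP[/eqP->|/andP[wv ws]].
      by rewrite w0s mE mulr1 subrr add0r eq_sym (negPf vw0) !mulr0.
    rewrite (negPf wv) (negPf ws) !mulr0 subr0 addr0.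
    have [_ _ xs1] := bs1; apply: xs1.
    move: s1K'; rewrite finset.in_setU finset.in_set2.
    case/orP=> [/orP[]/eqP->|s1K] //.
      by rewrite !inE (negPf wv).
    by case: cK => _ cK; case/negP: sK; apply: cK s1K ss1 s0.
- apply: bary_sub bs1; move: s1K'; rewrite finset.in_setU finset.in_set2.
  case/orP=> [/orP[]/eqP->|s1K] //.
    exact: finset.subsetUr.
  by case: cK => _ cK; case/negP: sK; apply: cK s1K ss1 s0.
Qed.

(* Since [s] is maximal and all its proper faces lie in [K], a sphere that
   misses a neighbourhood of the interior point [p] of [s] can be pushed
   radially from [p] into [K]. *)
Lemma fillable_attach K s : complex K -> complex (s |: K)%SET ->
  (1 < #|s|)%N -> s \notin K ->
  (forall t, t \proper s -> t != finset.set0 -> t \in K) ->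
  (forall phi, (forall v, lip (phi^~ v)) ->
     (exists p e, [/\ 0 < e, bary s p, forall w, w \in s -> 0 < p w
       & forall u, sphere u -> exists w, e <= `|phi u w - p w|])) ->
  fillable K -> fillable (s |: K)%SET.
Proof.
move=> cK cK' s2 sK fs avoid fK phi lphi phiK'.
have [p [e [e0 bp p0 pP]]] := avoid phi lphi.
have [pge0 p1 ps] := bp.
have [w1 w1s] : exists w, w \in s by apply/card_gt0P; exact: ltnW.
(* [m x] is the largest multiple of [p] whose subtraction leaves [x] non-negative; the remainder,
   rescaled to total mass one, is the radial projection of [x] from [p]. *)
pose m x := \big[Num.min/x w1 / p w1]_(w in s) (x w / p w).
pose r x w := (x w - m x * p w) * (1 - m x)^-1.
have lm : lip (fun u => m (phi u)).
  by apply: lip_bigmin => [|w]; apply: lipM => //; exact: lip_cst.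
have mle x w : (forall w', 0 <= x w') -> m x * p w <= x w.
  move=> x0; case: (boolP (w \in s)) => ws; last by rewrite ps // mulr0.
  rewrite -ler_pdivlMr ?p0 //.
  exact: (bigmin_le_cond _ (fun w => x w / p w)).
(* Write [x] as [m x * p + y] with [y >= 0] of total mass [1 - m x]: each coordinate of [x - p] is
   then a difference of two numbers between 0 and [1 - m x]. The bound keeps the denominator of [r]
   away from zero, so that [r] is Lipschitz along [phi]. *)
have me u : sphere u -> e <= 1 - m (phi u).
  move=> Su; have [x0 x1 _] := phiK' u Su; set x := phi u in x0 x1 *.
  have [w ew] := pP u Su; rewrite -/x in ew; apply: le_trans ew _.
  have y0 w' : 0 <= x w' - m x * p w' by rewrite subr_ge0 mle.
  have y1 : \sum_w' (x w' - m x * p w') = 1 - m x.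
    by rewrite sumrB x1 -mulr_sumr p1 mulr1.
  have yw : x w - m x * p w <= 1 - m x.
    by rewrite -y1 (bigD1 w) //= lerDl sumr_ge0.
  have m1 : 0 <= 1 - m x by exact: le_trans yw.
  have pw1 : p w <= 1 by exact: bary_le1 bp.
  have := mulr_ge0 m1 (pge0 w).
  have := ler_piMr m1 pw1; have := y0 w; move: yw.
  by rewrite ler_norml; lra.
apply: (fillable_retract (r := r) cK cK') => //.
- exact: finset.subsetUr.
- move=> w; apply: lipM.
    by apply: lipB => //; apply: lipM => //; exact: lip_cst.
  by apply: (lip_inv e0 me); apply: lipB => //; exact: lip_cst.
move=> u Su; have [x0 x1] := phiK' u Su; have := me u Su.
set x := phi u in x0 x1 *; set s1 := supp x => em s1K'.
have m1 : 0 < 1 - m x by exact: lt_le_trans em.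
have bs1 : bary s1 x by exact: bary_supp.
have [w0 w0s mE] := minimum_attained (fun w => x w / p w) w1s.
rewrite -/(m x) in mE.
have [ss1|] := boolP (s \subset s1); last first.
  case/fintype.subsetPn => w ws; rewrite inE negbK => /eqP xw.
  have m0 : m x = 0.
    apply/eqP; rewrite eq_le {2}mE divr_ge0 // andbT.
    by rewrite -(pmulr_lle0 _ (p0 w ws)) -xw mle.
  exists s1, s1; split=> //.
    move: s1K'; rewrite !inE => /orP[/eqP sE|//].
    have : w \in s1 by rewrite sE.
    by rewrite inE xw eqxx.
  suff -> : r x = x by [].
  by apply/funext => w'; rewrite /r m0 mul0r !subr0 invr1 mulr1.
have s1E : s1 = s.
  move: s1K'; rewrite !inE => /orP[/eqP//|s1K].
  case: cK => _ cK; case/negP: sK; apply: cK s1K ss1 _.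
  by apply/finset.set0Pn; exists w1.
exists (s :\ w0)%SET, s; split.
- apply: fs; first exact: properD1.
  by rewrite -card_gt0; move: s2; rewrite (cardsD1 w0 s) w0s.
- by rewrite !inE eqxx.
- exact: subD1set.
- split=> [w||w].
  + by rewrite /r mulr_ge0 ?invr_ge0 ?subr_ge0 ?mle // -subr_ge0 ltW.
  + rewrite /r -mulr_suml sumrB x1 -mulr_sumr p1 mulr1 divff //.
    by rewrite gt_eqF.
  + rewrite !inE negb_and negbK /r => /orP[/eqP->|ws].
      by rewrite mE divfK ?subrr ?mul0r // gt_eqF // p0.
    have [_ _ xs1] := bs1.
    by rewrite xs1 ?s1E // ps // mulr0 subr0 mul0r.
- by rewrite -s1E.
Qed.

(** A bound [k] on the box dimension of the sphere, the pieces of a subdivision being the fibres of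
    [c]. *)
Definition thin k := exists A : nat, forall N, (0 < N)%N ->
  exists (T : finType) (c : E -> T), (#|T| <= A * N ^ k)%N /\
    forall u u' : E, sphere u -> sphere u' -> c u = c u' ->
      `|u - u'| <= N%:R^-1.

(* Pigeonhole: the simplex [s] contains [M ^ k.+1] points that are pairwise
   [1 / (2 * #|s| * M)] apart, while a Lipschitz image of the sphere is covered
   by O(M^k) sets of diameter O(1/M). *)
Lemma lip_avoid k s phi : thin k -> (k.+1 < #|s|)%N ->
  (forall v, lip (phi^~ v)) ->
  exists p e, [/\ 0 < e, bary s p, forall w, w \in s -> 0 < p w
    & forall u, sphere u -> exists w, e <= `|phi u w - p w|].
Proof.
move=> [A thinA] ks lphi; have [C C0 CP] := lip_uniform lphi.
have [v0 v0s] : exists v, v \in s.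
  by apply/card_gt0P; apply: leq_ltn_trans ks.
pose s' := (s :\ v0)%SET.
have cs : #|s| = #|s'|.+1 by rewrite (cardsD1 v0 s) v0s.
pose n : R := #|s|%:R.
have n0 : 0 < n by rewrite /n cs ltr0n.
(* With this [c], each coordinate of [phi] varies by at most [4 * e] on a piece of diameter
   [1 / (c * M)], for the [e] below. *)
pose c := (Num.truncn (4 * C * n)).+1.
have cP : 4 * C * n < c%:R by exact: truncnS_gt.
(* Chosen so that the number of pieces, at most [A * (c * M) ^ k], is less than [M ^ k.+1]. *)
pose M := (A * c ^ k).+1.
have M0 : 0 < M%:R :> R by rewrite ltr0n.
have c0 : 0 < c%:R :> R by rewrite ltr0n.
have [|T [cell [cardT cellP]]] := thinA (c * M)%N; first by rewrite muln_gt0.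
(* Grid coordinates lie between [1 / (2 * n)] and [1 / n], in steps of [1 / (2 * n * M)]; over the
   [n - 1] vertices of [s'] they sum to less than one, which leaves positive mass for [v0]. *)
pose coord (j : {ffun P -> 'I_M}) w : R := (1 + (j w)%:R / M%:R) / (2 * n).
pose pt j w := if w \in s' then coord j w
               else if w == v0 then 1 - \sum_(w' in s') coord j w' else 0.
have coord_gt0 j w : 0 < coord j w.
  by rewrite divr_gt0 ?mulr_gt0 // ltr_pwDl // divr_ge0 // ltW.
have coord_lt j w : coord j w <= n^-1.
  rewrite /coord ler_pdivrMr ?mulr_gt0 // mulrCA mulVf ?gt_eqF // mulr1.
  have : (j w)%:R / M%:R <= 1 :> R.
    by rewrite ler_pdivrMr // mul1r ler_nat ltnW.
  lra.
have sum_lt j : \sum_(w in s') coord j w < 1.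
  apply: (@le_lt_trans _ _ (\sum_(w in s') n^-1)); first exact: ler_sum.
  rewrite sumr_const -mulr_natl ltr_pdivrMr // mul1r ltr_nat cs.
  exact: ltnSn.
have bpt j : bary s (pt j).
  split=> [w||w ws].
  - rewrite /pt; case: ifP => _; first exact: ltW.
    by case: ifP => _ //; rewrite subr_ge0 ltW.
  - rewrite (bigID [in s']) /= [X in _ + X](bigD1 v0) /=; last first.
      by rewrite !inE eqxx.
    rewrite [X in _ + (_ + X)]big1 ?addr0; last first.
      by move=> w /andP[ws' wv]; rewrite /pt (negPf ws') (negPf wv).
    rewrite {2}/pt !inE !eqxx /= addrC.
    have -> : \sum_(w in s') pt j w = \sum_(w in s') coord j w.
      by apply: eq_bigr => w ws'; rewrite /pt ws'.
    by rewrite subrK.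
  - rewrite /pt ifF; last by rewrite !inE (negPf ws) andbF.
    by rewrite ifF //; apply: contraNF ws => /eqP->.
have pt_gt0 j w : w \in s -> 0 < pt j w.
  move=> ws; rewrite /pt !inE ws andbT; case: eqP => /= _ //.
  by rewrite subr_gt0.
pose e : R := (16 * n * M%:R)^-1.
have e0 : 0 < e by rewrite invr_gt0 !mulr_gt0.
apply: contrapT => nP.
have bad j : exists u, sphere u /\ forall w, `|phi u w - pt j w| < e.
  apply: contrapT => nj; apply: nP; exists (pt j), e; split=> // [|u Su].
    exact: pt_gt0.
  apply: contrapT => nw; apply: nj; exists u; split=> // w.
  by rewrite ltNge; apply/negP => ew; apply: nw; exists w.
have [u uP] := choice bad.
pose J := pffun_on (ord0 : 'I_M) s' predT.
have : ~ {in J &, injective (fun j => cell (u j))}.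
  move=> inj; have := leq_card_in _ _ inj; rewrite card_pffun_on.
  have -> : #|@predT 'I_M| = M by exact: card_ord.
  apply/negP; rewrite -ltnNge; apply: leq_ltn_trans cardT _.
  apply: (@leq_trans (M ^ k.+1)); last by rewrite leq_pexp2l // -ltnS -cs.
  by rewrite expnS expnMn mulnA ltn_mul2r expn_gt0 /= ltnS.
apply => j j' jJ j'J cjj'; apply/eqP/negPn/negP => jj'.
have [w ws' jw] : exists2 w, w \in s' & j w != j' w.
  apply: contrapT => same; case/negP: jj'; apply/eqP/ffunP => w.
  have [ws'|ws'] := boolP (w \in s').
    by apply/eqP/negPn/negP => jw; apply: same; exists w.
  have off i : i \in J -> i w = ord0.
    case/pffun_onP => /fintype.subsetP sub _; apply/eqP.
    by apply: contraNT ws' => iw; apply: sub; rewrite inE.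
  by rewrite !off.
have [Su uj] := uP j; have [Su' uj'] := uP j'.
have close := CP w _ _ Su Su'.
have := cellP _ _ Su Su' cjj'; rewrite natrM invfM => near_.
have {near_}close : `|phi (u j) w - phi (u j') w| <= C * (c%:R^-1 * M%:R^-1).
  by apply: le_trans close _; exact: ler_wpM2l.
have small : C * (c%:R^-1 * M%:R^-1) <= 4 * e.
  rewrite /e !invfM mulrA [leRHS]mulrA ler_pM2r ?invr_gt0 //.
  rewrite ler_pdivrMr // -ler_pdivrMl; last by rewrite !mulr_gt0 ?invr_gt0.
  rewrite !invfM !invrK; lra.
have far : 8 * e <= `|pt j w - pt j' w|.
  rewrite /pt ws' /coord -mulrBl opprD addrACA subrr add0r -mulrBl.
  rewrite !normrM [`|M%:R^-1|]ger0_norm; last by rewrite invr_ge0 ltW.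
  rewrite [`|(2 * n)^-1|]ger0_norm; last by rewrite invr_ge0 ltW // mulr_gt0.
  have : 1 <= `|(j w)%:R - (j' w)%:R| :> R.
    move: jw; rewrite -(inj_eq val_inj) /= neq_ltn => /orP[] lt_jw; move: lt_jw;
      rewrite -(ler_nat R) -natr1 => lt_jw; [rewrite distrC|];
      apply: le_trans (ler_norm _); lra.
  move=> jw1; rewrite /e !invfM.
  have -> : 8 * (16^-1 * n^-1 * M%:R^-1) = 1 * M%:R^-1 * (2^-1 * n^-1) :> R.
    by field; rewrite !gt_eqF.
  by rewrite ler_pM2r ?mulr_gt0 ?invr_gt0 // ler_pM2r ?invr_gt0.
(* Coordinates at least [8 * e] apart would differ by less than [e + 4 * e + e]. *)
have := uj w; have := uj' w; move: far close.
have := ler_distD (phi (u j) w) (pt j w) (pt j' w).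
have := ler_distD (phi (u j') w) (phi (u j) w) (pt j' w).
rewrite [`|pt j w - phi _ _|]distrC; move: small e0; lra.
Qed.

(** [build k.+1] attaches only simplices of dimension above [k], as [lip_avoid] requires for a
    sphere that is thin in dimension [k]. *)
Lemma build_fillable k K : thin k -> build k.+1 K -> fillable K.
Proof.
move=> th; elim=> {K} [v|K s v bK IH s0 sK vs fs|K s bK IH ks sK fs].
- exact: fillable_vertex.
- apply: fillable_expand => //; first exact: build_complex bK.
  exact: build_complex (Build_expand bK s0 sK vs fs).
- apply: fillable_attach => //; first exact: build_complex bK.
    exact: build_complex (Build_attach bK ks sK fs).
  + exact: leq_trans ks.
  + by move=> phi lphi; exact: lip_avoid th ks lphi.
Qed.

End Filling.

(* Cutting off the coordinates at a small height keeps the support inside that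
   of [phi u], so the segments from [phi] to its Lipschitz approximation stay in
   the realization. *)
Lemma fillable_continuous (R : realType) (P : finType) (E : normedModType R)
    (K : {set {set P}}) (phi : E -> P -> R) :
  compact (@sphere R E) -> complex K -> fillable E K ->
  (forall v, {within sphere, continuous (phi^~ v)}) ->
  (forall u, sphere u -> geom K (phi u)) -> extendable (geom K) phi.
Proof.
move=> cS cK fK cphi phiK.
(* Each coordinate loses at most [2 * e] in passing from [phi u] to [h u], so at least half of the
   total mass remains; the successor keeps [n] positive when [P] is empty. *)
pose n : R := #|P|.+1%:R; pose e := (4 * n)^-1.
have n0 : 0 < n by rewrite ltr0n.
have e0 : 0 < e by rewrite invr_gt0 mulr_gt0.
have bphi u : sphere u -> bary (supp (phi u)) (phi u).
  by move=> /phiK[phi0 phi1 _]; exact: bary_supp.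
have approx v : exists g : E -> R, lip g /\
    forall u, sphere u -> phi u v - e <= g u <= phi u v.
  have [|g lg gP] := lip_approx cS (cphi v) _ e0; last by exists g.
  move=> u Su; have bu := bphi u Su; rewrite (bary_le1 v bu) andbT.
  by case: bu.
have [g gP] := choice approx.
pose h u v := Num.max (g v u - e) 0; pose S u := \sum_v h u v.
have h0 u v : 0 <= h u v by rewrite /h le_max lexx orbT.
have S2 u : sphere u -> 2^-1 <= S u.
  move=> Su; have [_ phi1 _] := bphi u Su.
  apply: (@le_trans _ _ (\sum_v (phi u v - 2 * e))); last first.
    apply: ler_sum => v _; rewrite /h le_max; apply/orP; left.
    by have [_ /(_ u Su)/andP[h1 h2]] := gP v; lra.
  rewrite sumrB phi1 sumr_const -[X in 1 - X]mulr_natl.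
  have : #|P|%:R * e <= n * e by rewrite ler_pM2r // ler_nat.
  have -> : n * e = 4^-1 by rewrite /e invfM mulrCA mulfV ?mulr1 // gt_eqF.
  lra.
have S0 u : sphere u -> 0 < S u by move=> /S2; lra.
pose phi' u v := h u v * (S u)^-1.
have lh v : lip (h^~ v).
  apply: lip_max; last exact: lip_cst.
  by apply: lipB; [case: (gP v)|exact: lip_cst].
have lphi' v : lip (phi'^~ v).
  by apply: lipM => //; apply: lip_inv S2 _; [rewrite invr_gt0|exact: lip_sum].
have bphi' u : sphere u -> bary (supp (phi u)) (phi' u).
  move=> Su; split=> [v||v].
  - by rewrite mulr_ge0 // invr_ge0 ltW // S0.
  - by rewrite -mulr_suml divff // gt_eqF // S0.
  - rewrite inE negbK => /eqP xv; rewrite /phi' /h max_r ?mul0r //.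
    by have [_ /(_ u Su)/andP[h1 h2]] := gP v; lra.
have suppK u : sphere u -> supp (phi u) \in K by move=> /phiK[].
apply: (extend_homotopy (phi' := phi')) => //.
- by move=> v; exact: lip_continuous.
- move=> u r Su r01; apply/(geomP _ cK); exists (supp (phi u)).
    exact: suppK.
  by apply: bary_conv => //; [exact: bphi'|exact: bphi].
- apply: fK => // u Su; apply/(geomP _ cK); exists (supp (phi u)).
    exact: suppK.
  exact: bphi'.
Qed.

(** * The unit sphere of the sup norm *)

Section RowVectors.
Context {R : realType}.

Lemma row_entry_le n (u : 'rV[R]_n) i : `|u ord0 i| <= `|u|.
Proof.
rewrite [leRHS]/Num.norm /= mx_normrE.
by apply/bigmax_geP; right => /=; exists (ord0, i).
Qed.

Lemma row_norm_le n (u : 'rV[R]_n) r : 0 <= r ->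
  (forall i, `|u ord0 i| <= r) -> `|u| <= r.
Proof.
move=> r0 ur; rewrite [leLHS]/Num.norm /= mx_normrE.
by apply/bigmax_leP; split=> // -[i j] _ /=; rewrite ord1.
Qed.

Lemma row_norm_eq1 n (u : 'rV[R]_n) : `|u| = 1 -> exists i, `|u ord0 i| = 1.
Proof.
move=> u1; have [|[i j] /= uij] := @mx_norm_neq0 _ _ _ u.
  by rewrite -[mx_norm u]/`|u| u1 oner_neq0.
by exists j; move: uij; rewrite (ord1 i) => <-.
Qed.

Lemma compact_row_sphere n : compact (@sphere R 'rV[R]_n).
Proof.
apply: bounded_closed_compact.
  exists 1; split=> [|M M1 u]; first exact: num_real.
  by rewrite /sphere /= => ->; exact: ltW.
have -> : @sphere R 'rV[R]_n = [set u | `|u| <= 1] `&` [set u | 1 <= `|u|].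
  apply/seteqP; split=> u; rewrite /sphere /=; first by move=> ->.
  by move=> [u1 u1']; apply/eqP; rewrite eq_le u1.
by apply: closedI; [exact: closed_norm_le|exact: closed_norm_ge].
Qed.

(* A point of the sphere has a coordinate equal to 1 or -1: its index, its sign
   and a rounding of the other coordinates determine a piece. *)
Lemma row_thin k : thin 'rV[R]_k.+1 k.
Proof.
exists (k.+1 * 2 * 3 ^ k)%N => N N0.
(* For [x] between -1 and 1, [(x + 1) * N] lies between 0 and [2 * N], so its integer part takes at
   most [2 * N + 1 <= 3 * N] values, whence [3 ^ k]. *)
pose m := (2 * N).+1.
have NR : 0 < N%:R :> R by rewrite ltr0n.
pose idx (u : 'rV[R]_k.+1) := odflt ord0 [pick i | `|u ord0 i| == 1].
pose cell (x : R) : 'I_m := inord (Num.truncn ((x + 1) * N%:R)).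
exists ('I_k.+1 * bool * {ffun 'I_k -> 'I_m})%type.
exists (fun u => (idx u, 0 <= u ord0 (idx u),
          [ffun j => cell (u ord0 (lift (idx u) j))])); split.
  rewrite !card_prod card_ord card_bool card_ffun !card_ord -!mulnA -expnMn.
  rewrite !leq_mul2l; apply/orP; right; apply/orP; right.
  have [->|k0] := posnP k; first by rewrite !expn0.
  by rewrite leq_exp2r // /m; lia.
have idxP (u : 'rV[R]_k.+1) : sphere u -> `|u ord0 (idx u)| = 1.
  move=> /row_norm_eq1[i ui]; rewrite /idx; case: pickP => [j /eqP//|/(_ i)].
  by rewrite ui eqxx.
have cellP x y : `|x| <= 1 -> `|y| <= 1 -> cell x = cell y ->
    `|x - y| <= N%:R^-1.
  rewrite !ler_norml => /andP[x0 x1] /andP[y0 y1] /(congr1 val).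
  have bnd (z : R) : -1 <= z -> z <= 1 -> 0 <= (z + 1) * N%:R /\
      (Num.truncn ((z + 1) * N%:R) < m)%N.
    move=> z0 z1; have z1N : 0 <= (z + 1) * N%:R.
      by rewrite mulr_ge0 // -lerBlDr sub0r.
    split=> //; rewrite ltnS -(ler_nat R) natrM.
    apply: (@le_trans _ _ ((z + 1) * N%:R)); first by rewrite truncn_le.
    by rewrite ler_pM2r //; lra.
  have [X0 Xm] := bnd x x0 x1; have [Y0 Ym] := bnd y y0 y1.
  rewrite /= !inordK // => XY.
  have := truncn_itv X0; have := truncn_itv Y0; rewrite XY -natr1.
  set t := (Num.truncn _)%:R => /andP[ty yt] /andP[tx xt].
  rewrite -ler_norml -(ler_pM2r NR) mulVf ?gt_eqF //.
  have -> : `|x - y| * N%:R = `|(x - y) * N%:R|.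
    by rewrite normrM (gtr0_norm NR).
  by rewrite ler_norml; apply/andP; split; lra.
move=> u u' Su Su' [ii ss ff]; apply: row_norm_le.
  by rewrite invr_ge0 ltW.
move=> i; rewrite !mxE; have := idxP u Su; have := idxP u' Su'.
rewrite -ii in ss ff *.
(* At the common index both coordinates are 1 or both are -1. *)
have [<-|ni] := eqVneq (idx u) i.
  move=> h' h; have -> : u ord0 (idx u) - u' ord0 (idx u) = 0.
    move: ss h h'; case: (ger0P (u ord0 (idx u))) => _;
      case: (ger0P (u' ord0 (idx u))) => _ // _; lra.
  by rewrite normr0 invr_ge0 ltW.
move=> _ _; have [j ji _] := unlift_some ni; rewrite ji.
apply: cellP.
- by rewrite -[leRHS]Su; exact: row_entry_le.
- by rewrite -[leRHS]Su'; exact: row_entry_le.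
- by move/ffunP: ff => /(_ j); rewrite !ffunE.
Qed.

End RowVectors.

(** * Homotopy groups of realizations *)

Lemma dist_continuous (R : realType) (V W : normedModType R) (F : V -> W) C :
  0 <= C -> (forall u w, `|F u - F w| <= C * `|u - w|) -> continuous F.
Proof.
move=> C0 FC u; apply/cvgrPdist_le => e e0.
have Ce : 0 < e / (C + 1) by rewrite divr_gt0 // ltr_wpDl.
have := @nbhsx_ballx _ _ u _ Ce; apply: filterS => w.
rewrite -ball_normE /= => uw; apply: le_trans (FC _ _) _.
apply: (@le_trans _ _ (C * (e / (C + 1)))).
  by apply: ler_wpM2l => //; exact: ltW.
rewrite mulrA ler_pdivrMr ?ltr_wpDl // mulrC ler_wpM2l //; first exact: ltW.
by rewrite lerDl.
Qed.

Lemma within_continuous_ptws (R : realType) (P : finType) (T : topologicalType)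
    (A : set T) (f : T -> {ptws P -> R}) :
  {within A, continuous f} <->
  forall v, {within A, continuous (fun u => f u v)}.
Proof.
split=> [/subspace_continuousP cf v|cf]; apply/subspace_continuousP => u Au.
  have := cvg_comp _ _ (cf u Au) (@proj_continuous P (fun=> R) v (f u)).
  exact.
apply/cvg_sup => v U [? /= [[W oW <-]]] /= Wfu /filterS; apply.
have /subspace_continuousP := cf v => /(_ u Au); apply.
exact: open_nbhs_nbhs.
Qed.

Section Homotopies.
Context {R : realType} {P : finType} (K : scomplex P).
Notation X := (realization R K).

Lemma scomplex_complex : complex (simplices K).
Proof. by split; [exact: simplices_neq0|exact: simplices_face]. Qed.

Lemma realization_neq0 d : build d (simplices K) -> X !=set0.
Proof.
case/build_neq0 => s sK; have /finset.set0Pn[v vs] : s != finset.set0.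
  by apply: contraTneq sK => ->; exact: simplices_neq0.
exists (fun w => (w == v)%:R); split=> [w||]; first exact: ler0n.
  rewrite (bigD1 v) //= eqxx big1 ?addr0 // => w /negPf wv.
  by rewrite wv.
rewrite (_ : [set _ | _]%SET = [set v]%SET).
  apply: simplices_face sK _ _; first by rewrite finset.sub1set.
  by rewrite -card_gt0 cards1.
by apply/setP => w; rewrite !inE pnatr_eq0 eqb0 negbK.
Qed.

(* Affine identification of the ball of the sup norm in dimension [k.+1] with
   the product of the unit [k]-cube and the unit interval. *)
Definition cube_time k (w : 'rV[R]_k.+1) : R := (w ord0 ord0 + 1) / 2.
Definition cube_base k (w : 'rV[R]_k.+1) : 'rV[R]_k :=
  \row_j ((w ord0 (lift ord0 j) + 1) / 2).
Definition cube_join k (p : 'rV[R]_k * R) : 'rV[R]_k.+1 :=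
  \row_i (2 * (if unlift ord0 i is Some j then p.1 ord0 j else p.2) - 1).

Lemma cube_time_join k (p : 'rV[R]_k * R) : cube_time (cube_join p) = p.2.
Proof. by rewrite /cube_time mxE unlift_none subrK mulrC mulKf. Qed.

Lemma cube_base_join k (p : 'rV[R]_k * R) : cube_base (cube_join p) = p.1.
Proof.
by apply/rowP => j; rewrite !mxE liftK subrK mulrC mulKf.
Qed.

Lemma cube_time_continuous k : continuous (@cube_time k).
Proof.
apply: (@dist_continuous _ _ _ _ 1) => // u w; rewrite mul1r /cube_time.
have -> : (u ord0 ord0 + 1) / 2 - (w ord0 ord0 + 1) / 2 =
          (u - w) ord0 ord0 / 2 by rewrite !mxE; field.
rewrite normrM; apply: le_trans (row_entry_le (u - w) ord0).
by rewrite ler_piMr // ger0_norm ?invr_ge0 // invf_le1 ?ler1n.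
Qed.

Lemma cube_base_continuous k : continuous (@cube_base k).
Proof.
apply: (@dist_continuous _ _ _ _ 1) => // u w; rewrite mul1r.
apply: row_norm_le => // j; rewrite !mxE.
have -> : (u ord0 (lift ord0 j) + 1) / 2 - (w ord0 (lift ord0 j) + 1) / 2 =
          (u - w) ord0 (lift ord0 j) / 2 by rewrite !mxE; field.
rewrite normrM; apply: le_trans (row_entry_le (u - w) (lift ord0 j)).
by rewrite ler_piMr // ger0_norm ?invr_ge0 // invf_le1 ?ler1n.
Qed.

Lemma cube_join_continuous k : continuous (@cube_join k).
Proof.
apply: (@dist_continuous _ _ _ _ 2) => // p q.
apply: row_norm_le => [|i]; first by rewrite mulr_ge0.
rewrite !mxE; set a := (if _ is Some _ then p.1 _ _ else _).
set b := (if _ is Some _ then q.1 _ _ else _).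
have -> : 2 * a - 1 - (2 * b - 1) = 2 * (a - b) by ring.
rewrite normrM ger0_norm // ler_pM2l // /a /b.
case: unliftP => [j _|_]; rewrite prod_normE le_max.
  by have := row_entry_le (p.1 - q.1) j; rewrite !mxE => ->.
by rewrite lexx orbT.
Qed.

Lemma cube_join_disk k (u : 'rV[R]_k) r : cube u -> 0 <= r <= 1 ->
  disk (cube_join (u, r)).
Proof.
move=> cu r01; apply: row_norm_le => // i; rewrite mxE.
have : 0 <= (if unlift ord0 i is Some j then u ord0 j else r) <= 1.
  by case: unlift => [j|] //; exact: cu.
by rewrite ler_norml /=; lra.
Qed.

Lemma cube_join_sphere k (u : 'rV[R]_k) r : cube u -> 0 <= r <= 1 ->
  cube_boundary u \/ r = 0 \/ r = 1 -> sphere (cube_join (u, r)).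
Proof.
move=> cu r01 bd; apply/eqP; rewrite eq_le; apply/andP; split.
  exact: cube_join_disk.
have [i ->] : exists i, 1 = `|cube_join (u, r) ord0 i|; last first.
  exact: row_entry_le.
case: bd => [[_ [j uj]]|r_bd].
  exists (lift ord0 j); rewrite mxE liftK.
  by case: uj => /= ->; rewrite ?mulr0 ?mulr1 ?sub0r ?normrN ?normr1 //;
    rewrite [1 in RHS]lock; unlock; rewrite ger0_norm; lra.
exists ord0; rewrite mxE unlift_none /=.
by case: r_bd => ->; rewrite ?mulr0 ?mulr1 ?sub0r ?normrN ?normr1 //;
  rewrite ger0_norm; lra.
Qed.

Lemma sphere_cube k (w : 'rV[R]_k.+1) : sphere w ->
  [/\ cube (cube_base w), 0 <= cube_time w <= 1
    & cube_boundary (cube_base w) \/ cube_time w = 0 \/ cube_time w = 1].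
Proof.
move=> Sw; have w1 i : -1 <= w ord0 i <= 1.
  by rewrite -ler_norml -[leRHS]Sw; exact: row_entry_le.
have cb : cube (cube_base w).
  by move=> j; rewrite mxE; have := w1 (lift ord0 j); lra.
split=> //; first by rewrite /cube_time; have := w1 ord0; lra.
have [i wi] := row_norm_eq1 Sw.
have {}wi : w ord0 i = 1 \/ w ord0 i = -1.
  have : `|w ord0 i| = `|1| by rewrite wi normr1.
  by move/eqP; rewrite eqr_norm2 => /orP[]/eqP; [left|right].
case: (unliftP ord0 i) => [j ij|i0].
  left; split=> //; exists j; rewrite mxE -ij.
  by case: wi => ->; [right|left]; lra.
by right; rewrite /cube_time -i0; case: wi => ->; [right|left]; lra.
Qed.

(* Filling the interpolation [phi] between [f] and [g] on the boundary of the
   cylinder yields a homotopy; on the sides [phi] is [x], as [f] and [g] are. *)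
Lemma homotopic_build k x (f g : 'rV[R]_k -> {ptws P -> R}) :
  build k.+1 (simplices K) -> sphere_map X x f -> sphere_map X x g ->
  homotopic_rel X x f g.
Proof.
move=> bK [cf fX fx] [cg gX gx].
pose phi (w : 'rV[R]_k.+1) v :=
  (1 - cube_time w) * f (cube_base w) v + cube_time w * g (cube_base w) v.
have phi0 w : cube_time w = 0 -> phi w = f (cube_base w).
  by move=> t0; apply/funext => v; rewrite /phi t0 subr0 mul1r mul0r addr0.
have phi1 w : cube_time w = 1 -> phi w = g (cube_base w).
  by move=> t1; apply/funext => v; rewrite /phi t1 subrr mul1r mul0r add0r.
have phix w : cube_boundary (cube_base w) -> phi w = x.
  by move=> bw; apply/funext => v; rewrite /phi fx // gx //; ring.
have [||psi [cpsi psiX psiE]] := @fillable_continuous _ _ _ (simplices K) phi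
    (@compact_row_sphere _ _) scomplex_complex (build_fillable (row_thin k) bK).
- have ct : {within @sphere R 'rV[R]_k.+1, continuous (@cube_time k)}.
    by apply: continuous_subspaceT; exact: cube_time_continuous.
  have cb (h : 'rV[R]_k -> {ptws P -> R}) v :
      {within @cube R k, continuous h} ->
      {within @sphere R 'rV[R]_k.+1, continuous (fun w => h (cube_base w) v)}.
    move=> /within_continuous_ptws/(_ v) ch.
    apply: (within_continuous_compose (g := @cube_base k) _ _ ch).
      by apply: continuous_subspaceT; exact: cube_base_continuous.
    by move=> w /sphere_cube[].
  move=> v w; apply: cvgD; apply: cvgM.
  + by apply: cvgB; [exact: cvg_cst|exact: ct].
  + exact: cb.
  + exact: ct.
  + exact: cb.
- move=> w /sphere_cube[cw _ [bw|[t0|t1]]].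
  + by rewrite phix // -(fx _ bw); exact: fX.
  + by rewrite phi0 //; exact: fX.
  + by rewrite phi1 //; exact: gX.
have itv01 (r : R) : 0 <= r <= 1 -> (`[0, 1]%classic : set R) r.
  by move=> r01; rewrite /= in_itv.
exists (fun p => psi (cube_join p)); split.
- apply/within_continuous_ptws => v.
  apply: (within_continuous_compose (g := @cube_join k) _ _ (cpsi v)).
    by apply: continuous_subspaceT; exact: cube_join_continuous.
  by move=> [u r] [/= cu]; rewrite in_itv /= => r01; exact: cube_join_disk.
- by move=> u r cu r01; apply: psiX; exact: cube_join_disk.
- move=> u cu; rewrite psiE ?phi0 ?cube_time_join ?cube_base_join //.
  by apply: cube_join_sphere; rewrite ?lexx ?ler01 //; right; left.
- move=> u cu; rewrite psiE ?phi1 ?cube_time_join ?cube_base_join //.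
  by apply: cube_join_sphere; rewrite ?lexx ?ler01 //; right; right.
- move=> u r bu r01; rewrite psiE ?phix ?cube_base_join //.
  by apply: cube_join_sphere; [case: bu| |left].
Qed.

Lemma homotopy_group_build k x : build k.+1 (simplices K) -> X x ->
  homotopy_group_trivial R k X x.
Proof.
move=> bK Xx.
have cx : @sphere_map R _ k X x (cst x).
  by split=> //; apply: continuous_subspaceT; exact: cst_continuous.
have classE f : sphere_map X x f ->
    homotopy_class X x f = @sphere_map R _ k X x.
  move=> fx; apply/seteqP; split=> [g []//|g gx].
  by split=> //; exact: homotopic_build.
rewrite /homotopy_group_trivial /homotopy_group; apply/seteqP; split.
  by move=> _ [f fx <-] /=; rewrite !classE.
by move=> _ ->; exists (cst x).
Qed.

(** This is the case [k = 0]: the cube is a point with empty boundary, so the constant maps at [x]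
    and at [y] are both sphere maps, and a homotopy between them is a path. *)
Lemma path_connected_build : build 1 (simplices K) -> path_connected R X.
Proof.
move=> bK; split=> [|x y Xx Xy]; first exact: realization_neq0 bK.
have sphere_cst z : X z -> @sphere_map R _ 0 X x (cst z).
  move=> Xz; split=> [|//|u [_ [[]]//]].
  by apply: continuous_subspaceT; exact: cst_continuous.
have [H [cH XH H0 H1 _]] :=
  homotopic_build bK (sphere_cst x Xx) (sphere_cst y Xy).
have c0 : @cube R 0 0 by case.
exists (fun r => H (0, r)); split.
- pose i (r : R) : 'rV[R]_0 * R := (0, r).
  apply: (within_continuous_compose (g := i) _ _ cH).
    apply/continuous_subspaceT/(@dist_continuous _ _ _ _ 1) => // r r'.
    by rewrite mul1r prod_normE /= subrr normr0 ge_max lexx normr_ge0.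
  by move=> r r01; split.
- by move=> r r01; exact: XH.
- exact: H0.
- exact: H1.
Qed.

End Homotopies.

Lemma path_connected_connected (R : realType) (T : topologicalType)
    (X : set T) : path_connected R X -> connected X.
Proof.
move=> [[x Xx] pX].
pose Q (g : R -> T) := [/\ {within (`[0, 1] : set R), continuous g},
  forall r : R, 0 <= r <= 1 -> X (g r) & g 0 = x].
have -> : X = \bigcup_(g in Q) (g @` (`[0, 1] : set R)).
  apply/seteqP; split=> [y Xy|y [g [_ gX _] [r r01 <-]]].
    have [g [cg gX g0 g1]] := pX x y Xx Xy.
    by exists g => //; exists 1 => //=; rewrite in_itv /= ler01 lexx.
  by apply: gX; move: r01; rewrite /= in_itv.
apply: bigcup_connected.
  by exists x => g [_ _ g0]; exists 0 => //=; rewrite in_itv /= lexx ler01.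
move=> g [cg _ _]; apply: connected_continuous_connected => //.
exact: segment_connected.
Qed.

Theorem corollary4p4 (R : realType) (V : finType) (G : scomplex V)
    (hG : is_graph G) :
  [/\ n_connected R (eta R G - 2) (realization R (morse_complex G)),
      (1 < #|edges G|)%N ->
        connected (realization R (morse_complex G)),
      (4 < #|edges G|)%N ->
        simply_connected R (realization R (morse_complex G))
    & forall m : nat, (1 <= m)%N -> (m ^ 2 < #|edges G|)%N ->
        n_connected R (m%:Z - 1) (realization R (morse_complex G))].
Proof.
have bM d : (d ^ 2 < #|edges G|)%N -> build d (simplices (morse_complex G)).
  exact: build_graph.
(* An integer below the ceiling of the square root is below the square root itself. *)
have etaP d : d%:Z < eta R G -> (d ^ 2 < #|edges G|)%N.
  apply: contraTT; rewrite -leqNgt -leNgt => Ed.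
  rewrite /eta ceil_le_int -[leRHS]ger0_norm ?ler0z // -sqrtr_sqr.
  by apply: ler_wsqrtr; rewrite -natrX ler_nat.
(* The level [k.+1] is the dimension of the disk to be filled by a homotopy of maps on the
   [k]-cube. *)
have trivial_pi k : (k.+1 ^ 2 < #|edges G|)%N ->
    forall x, realization R (morse_complex G) x ->
    homotopy_group_trivial R k (realization R (morse_complex G)) x.
  by move=> kE x; exact/homotopy_group_build/bM.
split.
- split=> [eta1|k k_eta].
    by apply: (realization_neq0 (bM 0%N _)); apply: etaP; lia.
  by apply/trivial_pi/etaP; lia.
- by move=> E1; apply/(@path_connected_connected R)/path_connected_build/bM.
- move=> E4; split.
    by apply/path_connected_build/bM; apply: leq_ltn_trans E4.
  exact: trivial_pi.
- move=> m m1 mE; split=> [_|k km].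
    by apply: (realization_neq0 (bM m _)).
  by apply: trivial_pi; apply: leq_ltn_trans mE; rewrite leq_exp2r //; lia.
Qed.
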